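(* Let $G$ be a finite solvable group. If $G$ has exactly $2$ or exactly $3$ irrational conjugacy classes, then $\pi(G) \subseteq \{2,3,5,7\}$.
   Context: A conjugacy class $K$ of a finite group $G$ is irrational if there is some complex irreducible character $\chi$ of $G$ with $\chi(K) \notin \mathbb{Q}$. $\pi(G)$ denotes the set of prime divisors of $|G|$. *)

(* Defs.v *)
From HB Require Import structures.
From mathcomp Require Import all_boot all_order all_algebra all_fingroup all_solvable all_field all_character.
Set Implicit Arguments. Unset Strict Implicit. Unset Printing Implicit Defensive.
Import GRing.Theory Num.Theory.
Local Open Scope ring_scope.

(* A conjugacy class K of G is irrational if some irreducible character of G
   takes a non-rational value on K (evaluated at a representative; class
   functions are constant on conjugacy classes). *)
Definition irrational_class (gT : finGroupType) (G : {group gT}) (K : {set gT}) : bool :=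
  [exists i : Iirr G, 'chi[G]_i (repr K) \notin Crat].

Definition irrational_classes (gT : finGroupType) (G : {group gT}) : {set {set gT}} :=
  [set K in (classes G) | irrational_class G K].

(* Main.v *)
Require Import Defs.
From mathcomp Require Import all_boot all_order all_algebra all_fingroup all_solvable all_field all_character.
From mathcomp Require Import zify.
Set Implicit Arguments. Unset Strict Implicit. Unset Printing Implicit Defensive.

(* Call x in G rational if x^j is conjugate to x for every j prime to |G|. Nonrational
   elements lie in irrational classes, so G has at most 3 classes of them; an orbit of the
   Galois group (Z/|G|)^* on these classes has at least 2 of them, so there is at most one orbit,
   and a subgroup L of index iota <= 3 fixes every class of G. In a minimal counterexample
   G = V : H, with V a minimal normal p-group, p >= 11, and H a {2,3,5,7}-group. Take
   U = C_V(B), of order p^m, where B = C_H(u) has maximal order for u in V^#: then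
   X = N_H(B)/B acts freely on U, so |X| divides p^m - 1 and the Sylow subgroups of X are
   nearly cyclic.
   The crucial point is that the spectrum of each y in N_H(B) on U is stable under L. For B = 1
   this is clear from Brauer characters. In general the Brauer character of U at y is the mean,
   over the coset yB, of that of V: for abelian B, the eigenspaces of B moved by y contribute 0,
   and those fixed by y contribute multiples of characters of B, whose mean is 0 unless they
   are trivial; solvable B follows by induction on the derived subgroup. Hence
   totient #[g] divides iota m for all g in X, which gives |X| %| 420 iota m.
   On the other hand, if all elements of V are rational, every u in U^# has, for each k prime
   to p, a (unique) g in X with u^g = u^k. Counting the pairs (u, g) with k of order e mod p,
   each g contributes eigenspaces of dimension at most m/o, where o is the L-orbit length of a
   primitive e-th root of unity; so X must have many elements of order e, contradicting the
   divisibility constraints. If some v in V is not rational, then C_H(v) = 1, iota = 1 for H,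
   and either B <> 1 and the same count applies to U, or U = V has at most 3|H| nonrational
   vectors, and the count applies to the other ones. *)

Import GRing.Theory Num.Theory GroupScope.
Local Open Scope ring_scope.

(** * Eigenspaces and Brauer characters *)

Section OrthIdem.
Variables (K : fieldType) (n : nat).
Implicit Types A B : 'M[K]_n.

(** A vector in both row spaces is fixed by [A] and also killed by it, because [B *m A = 0]; so the
    row spaces meet trivially. *)
Lemma mxrank_orth_idem A B :
  A *m A = A -> B *m B = B -> A *m B = 0 -> B *m A = 0 ->
  \rank (A + B)%R = (\rank A + \rank B)%N.
Proof.
move=> AA BB AB BA.
have cap0 : (A :&: B)%MS = 0.
  apply/eqP; rewrite -submx0; apply/rV_subP => v.
  rewrite sub_capmx => /andP[/submxP[x ->] /submxP[y Dy]].
  by rewrite -AA mulmxA Dy -mulmxA BA mulmx0 sub0mx.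
rewrite -(mxrank_disjoint_sum cap0); apply/eqmx_rank/andP; split.
  by rewrite addmx_sub_adds.
rewrite addsmx_sub; apply/andP; split.
  by apply/submxP; exists A; rewrite mulmxDr AA AB addr0.
by apply/submxP; exists B; rewrite mulmxDr BA BB add0r.
Qed.

Lemma mxrank_sum_orth_idem (I : finType) (Q : I -> 'M[K]_n) :
  (forall i, Q i *m Q i = Q i) -> (forall i j, i != j -> Q i *m Q j = 0) ->
  \rank (\sum_i Q i)%R = (\sum_i \rank (Q i))%N.
Proof.
move=> QQ Q0.
have gen (s : seq I) : uniq s ->
   (\rank (\sum_(i <- s) Q i)%R = \sum_(i <- s) \rank (Q i))%N
   /\ (\sum_(i <- s) Q i) *m (\sum_(i <- s) Q i) = \sum_(i <- s) Q i.
  elim: s => [|i s IHs]; first by rewrite !big_nil mxrank0 mulmx0.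
  case/andP=> s'i /IHs[rs idem_s]; rewrite !big_cons.
  have orl : Q i *m (\sum_(j <- s) Q j) = 0.
    rewrite mulmx_sumr big_seq big1 // => j sj; rewrite Q0 //.
    by apply: contraNneq s'i => ->.
  have orr : (\sum_(j <- s) Q j) *m Q i = 0.
    rewrite mulmx_suml big_seq big1 // => j sj; rewrite Q0 // eq_sym.
    by apply: contraNneq s'i => ->.
  by rewrite mxrank_orth_idem ?rs // mulmxDl !mulmxDr QQ orl orr idem_s addr0 add0r.
by have [] := gen (index_enum I) (index_enum_uniq I).
Qed.

End OrthIdem.

Lemma periodic_sum (V : nmodType) (N c : nat) (f : nat -> V) :
  (forall a, f (a + N)%N = f a) -> \sum_(a < N) f (a + c)%N = \sum_(a < N) f a.
Proof.
move=> perf; elim: c => [|c IHc]; first by apply: eq_bigr => a _; rewrite addn0.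
rewrite -{}IHc; case: N perf => [|N] perf; first by rewrite !big_ord0.
rewrite big_ord_recr [RHS]big_ord_recl /= addrC; congr (_ + _).
  by rewrite addnS -addSn addnC perf.
by apply: eq_bigr => i _; rewrite addnS -addSn.
Qed.

Section BrauerChar.
Variables (K : fieldType) (gT : finGroupType) (H : {group gT}) (n : nat).
Variable rH : mx_representation K H n.
Variables (N : nat) (w : K) (zeta : algC).
Hypothesis exponentN : {in H, forall x, (x ^+ N)%g = 1%g}.
Hypothesis prim_w : N.-primitive_root w.
Hypothesis prim_zeta : N.-primitive_root zeta.

Let N_gt0 : (N > 0)%N := prim_order_gt0 prim_w.
Let N_neq0 : N%:R != 0 :> K.
Proof. exact: (prim_root_natf_neq0 prim_w). Qed.
Let w_neq0 : w != 0.
Proof. by rewrite (prim_root_eq0 prim_w) -lt0n. Qed.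

(** The projection onto the [w ^+ a]-eigenspace of [z], as a Fourier coefficient of the powers of
    [z]. Since [N] is a common multiple of all element orders, one root [w] serves for the whole
    group. *)
Definition eigproj (z : gT) (a : nat) : 'M[K]_n :=
  N%:R^-1 *: \sum_(t < N) (w ^- (a * t)) *: rH (z ^+ t)%g.

Lemma eigproj_period z a : eigproj z (a + N) = eigproj z a.
Proof.
congr (_ *: _); apply: eq_bigr => t _; congr (_ *: _).
by rewrite mulnDl exprD [w ^+ (N * t)]exprM (prim_expr_order prim_w) expr1n mulr1.
Qed.

Lemma eigproj_comm_mul z a (P : 'M_n) (c : nat) : z \in H ->
  P *m rH z = (w ^- c) *: (rH z *m P) ->
  P *m eigproj z a = eigproj z (a + c) *m P.
Proof.
move=> Hz Pz; have Pzt t : P *m rH (z ^+ t)%g = (w ^- (c * t)) *: (rH (z ^+ t)%g *m P).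
  elim: t => [|t IHt]; first by rewrite muln0 expr0 invr1 scale1r !repr_mx1 mulmx1 mul1mx.
  rewrite expgSr repr_mxM ?groupX // mulmxA IHt -scalemxAl -mulmxA Pz -scalemxAr.
  by rewrite scalerA mulmxA mulnS addnC exprD invfM.
rewrite /eigproj -scalemxAr -scalemxAl; congr (_ *: _).
rewrite mulmx_sumr mulmx_suml; apply: eq_bigr => t _.
by rewrite -scalemxAr -scalemxAl Pzt scalerA -invfM -exprD -mulnDl.
Qed.

Lemma eigproj_comm z a (P : 'M_n) : z \in H ->
  P *m rH z = rH z *m P -> P *m eigproj z a = eigproj z a *m P.
Proof.
move=> Hz Pz; have := @eigproj_comm_mul z a P 0 Hz.
by rewrite addn0 => -> //; rewrite expr0 invr1 scale1r.
Qed.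

(** Orthogonality of the characters of Z/N: for [a] and [b] incongruent, the sum is a geometric
    series of ratio [q != 1] with [q ^+ N = 1]. *)
Lemma sum_unity_root a b :
  \sum_(t < N) (w ^- (a * t)) * (w ^+ (b * t)) = ((a == b %[mod N])%N)%:R * N%:R.
Proof.
have E t : (w ^- (a * t)) * (w ^+ (b * t)) = (w ^- a * w ^+ b) ^+ t.
  by rewrite exprMn exprVn -!exprM.
under eq_bigr do rewrite E.
have [ab | ab] := eqVneq (a %% N)%N (b %% N)%N.
  have /eqP -> : w ^- a * w ^+ b == 1.
    rewrite mulrC -[_ == 1](can_eq (mulfK (expf_neq0 a w_neq0))) mul1r mulfVK ?expf_neq0 //.
    by rewrite (eq_prim_root_expr prim_w) eq_sym ab eqxx.
  by rewrite mul1r; under eq_bigr do rewrite expr1n; rewrite sumr_const card_ord.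
rewrite mul0r; set q := _ * _.
have q1 : q != 1.
  apply: contra ab => /eqP q1; rewrite eq_sym -(eq_prim_root_expr prim_w) -[_ ^+ a]mulr1 -q1.
  by rewrite mulrA divff ?expf_neq0 // mul1r.
apply: (mulfI (_ : q - 1 != 0)); first by rewrite subr_eq0.
rewrite mulr0 -subrX1 /q exprMn exprVn -!exprM ![(_ * N)%N]mulnC !exprM.
by rewrite (prim_expr_order prim_w) !expr1n invr1 mulr1 subrr.
Qed.

Lemma eigproj_sum z : z \in H -> \sum_(a < N) eigproj z a = 1%:M.
Proof.
move=> Hz; rewrite /eigproj -scaler_sumr exchange_big /=.
have E (t : 'I_N) : \sum_(a < N) w ^- (a * t) *: rH (z ^+ t)%g
    = if t == Ordinal N_gt0 then N%:R *: rH 1%g else 0.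
  rewrite -scaler_suml.
  have -> : \sum_(a < N) w ^- (a * t) = \sum_(a < N) (w ^- (t * a)) * (w ^+ (0 * a)).
    by apply: eq_bigr => a _; rewrite mul0n mulr1 mulnC.
  rewrite sum_unity_root mod0n modn_small //.
  by rewrite -val_eqE /=; case: eqP => [->|_]; rewrite ?mul1r // mul0r scale0r.
under eq_bigr do rewrite E; rewrite -big_mkcond big_pred1_eq scalerA mulVf //.
by rewrite scale1r repr_mx1.
Qed.

Lemma eigproj_eig z a : z \in H -> eigproj z a *m rH z = w ^+ a *: eigproj z a.
Proof.
move=> Hz; rewrite /eigproj -scalemxAl scalerA mulrC -scalerA; congr (_ *: _).
rewrite mulmx_suml scaler_sumr.
pose f t := w ^- (a * t) * w ^+ a *: rH (z ^+ t)%g.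
transitivity (\sum_(t < N) f (t + 1)%N).
  apply: eq_bigr => t _; rewrite /f -scalemxAl -repr_mxM ?groupX // -expgSr addn1.
  by rewrite mulnS exprD invfM mulrAC mulVf ?expf_neq0 // mul1r.
rewrite periodic_sum => [|t]; last first.
  by rewrite /f mulnDr exprD [(a * N)%N]mulnC [w ^+ (N * a)]exprM (prim_expr_order prim_w) expr1n mulr1 expgD exponentN ?mulg1.
by apply: eq_bigr => t _; rewrite /f mulrC scalerA.
Qed.

Lemma eigproj_scalar z a (b : 'I_N) (Q : 'M_n) : z \in H ->
  Q *m rH z = w ^+ b *: Q -> Q *m eigproj z a = if (a == b %[mod N])%N then Q else 0.
Proof.
move=> Hz Qz; have Qzt t : Q *m rH (z ^+ t)%g = w ^+ (b * t) *: Q.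
  elim: t => [|t IHt]; first by rewrite muln0 scale1r repr_mx1 mulmx1.
  by rewrite expgSr repr_mxM ?groupX // mulmxA IHt -scalemxAl Qz scalerA mulnS addnC exprD.
rewrite /eigproj -scalemxAr mulmx_sumr.
under eq_bigr do rewrite -scalemxAr Qzt scalerA.
rewrite -scaler_suml sum_unity_root; case: eqP => _; last by rewrite mul0r scale0r scaler0.
by rewrite mul1r scalerA mulVf // scale1r.
Qed.

Lemma eigproj_mul z (a b : nat) : z \in H ->
  eigproj z a *m eigproj z b = if (b == a %[mod N])%N then eigproj z a else 0.
Proof.
move=> Hz; have lt_a : (a %% N < N)%N by rewrite ltn_mod.
rewrite (@eigproj_scalar z b (Ordinal lt_a)) //= ?modn_mod // eigproj_eig //.
by rewrite prim_expr_mod.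
Qed.

Local Notation eig := eigproj.

(** For an idempotent [P] commuting with [rH z], this is the Brauer character at [z] of the image of
    [P]: each eigenvalue [w ^+ a] is lifted to [zeta ^+ a]. Using [P] instead of a submodule avoids
    restricting the representation. *)
Definition brauer_char (P : 'M[K]_n) (z : gT) : algC :=
  \sum_(a < N) (\rank (P *m eig z a))%:R * zeta ^+ a.

Local Notation brauer := brauer_char.

Lemma brauer_sum (I : finType) (Q : I -> 'M[K]_n) z : z \in H ->
  (forall i, Q i *m Q i = Q i) -> (forall i j, i != j -> Q i *m Q j = 0) ->
  (forall i, Q i *m rH z = rH z *m Q i) ->
  brauer (\sum_i Q i) z = \sum_i brauer (Q i) z.
Proof.
move=> Hz QQ Q0 Qz; rewrite /brauer exchange_big /=; apply: eq_bigr => a _.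
rewrite mulmx_suml mxrank_sum_orth_idem.
- by rewrite natr_sum mulr_suml.
- move=> i; rewrite {2}(eigproj_comm _ Hz (Qz i)) mulmxA -[_ *m _ *m eig z a]mulmxA.
  rewrite eigproj_mul // eqxx -mulmxA -(eigproj_comm _ Hz (Qz i)) mulmxA.
  by rewrite QQ.
- move=> i j ne_ij; rewrite (eigproj_comm _ Hz (Qz j)) mulmxA -[_ *m _ *m eig z a]mulmxA.
  by rewrite eigproj_mul // eqxx -mulmxA -(eigproj_comm _ Hz (Qz j)) mulmxA Q0 ?mul0mx.
Qed.

Lemma brauer_shift P z y (b : nat) :
  (forall a, \rank (P *m eig z (a + b)) = \rank (P *m eig y a)) ->
  brauer P z = zeta ^+ b * brauer P y.
Proof.
move=> rk; pose f a := (\rank (P *m eig z a))%:R * zeta ^+ a.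
transitivity (\sum_(a < N) f (a + b)%N).
  rewrite periodic_sum // => a; rewrite /f eigproj_period exprD.
  by rewrite (prim_expr_order prim_zeta) mulr1.
by rewrite /brauer mulr_sumr; apply: eq_bigr => a _; rewrite /f rk exprD mulrA mulrC.
Qed.

Lemma brauer_scal P y d (b : nat) : y \in H -> d \in H ->
  P *m rH y = rH y *m P -> P *m rH d = w ^+ b *: P ->
  brauer P (y * d)%g = zeta ^+ b * brauer P y.
Proof.
move=> Hy Hd Py Pd; apply: brauer_shift => a; congr (\rank _).
have Pyt t : P *m rH (y ^+ t)%g = rH (y ^+ t)%g *m P.
  elim: t => [|t IHt]; first by rewrite expg0 repr_mx1 mulmx1 mul1mx.
  by rewrite expgSr repr_mxM ?groupX // mulmxA IHt -mulmxA Py mulmxA.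
have Pyd t : P *m rH ((y * d) ^+ t)%g = w ^+ (b * t) *: (P *m rH (y ^+ t)%g).
  elim: t => [|t IHt]; first by rewrite muln0 !expg0 scale1r.
  have Hyt := groupX t Hy; have Hydt := groupX t (groupM Hy Hd).
  rewrite expgSr repr_mxM ?groupM // mulmxA IHt -scalemxAl -mulmxA.
  rewrite -repr_mxM ?groupM // mulgA -expgSr repr_mxM ?groupX // mulmxA Pyt.
  by rewrite -mulmxA Pd -scalemxAr scalerA mulnS [(b + _)%N]addnC exprD.
rewrite /eigproj -!scalemxAr !mulmx_sumr; congr (_ *: _); apply: eq_bigr => t _.
by rewrite -!scalemxAr Pyd scalerA mulnDl exprD invfM mulfVK ?expf_neq0.
Qed.

Lemma eigprojJ z g a : z \in H -> g \in H ->
  eig (z ^ g)%g a = rH g^-1%g *m eig z a *m rH g.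
Proof.
move=> Hz Hg; rewrite /eigproj -scalemxAr -scalemxAl mulmx_sumr mulmx_suml.
congr (_ *: _); apply: eq_bigr => t _; rewrite -scalemxAr -scalemxAl -conjXg conjgE.
by rewrite !repr_mxM ?groupM ?groupX ?groupV // mulmxA.
Qed.

Lemma brauerJ P z g : z \in H -> g \in H ->
  brauer (rH g^-1%g *m P *m rH g) (z ^ g)%g = brauer P z.
Proof.
move=> Hz Hg; apply: eq_bigr => a _; congr (_%:R * _); rewrite eigprojJ //.
have -> : rH g^-1%g *m P *m rH g *m (rH g^-1%g *m eig z a *m rH g)
          = rH g^-1%g *m (P *m eig z a) *m rH g.
  by rewrite !mulmxA -[_ *m rH g *m rH g^-1%g]mulmxA -repr_mxM ?groupV // mulgV repr_mx1 mulmx1.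
rewrite (mxrankMfree (_ *m (P *m _))) ?row_free_unit ?repr_mx_unit //.
by rewrite (eqmxMfull (P *m eig z a)) ?row_full_unit ?repr_mx_unit ?groupV.
Qed.

Section Block.
Variables (I : finType) (s : {perm I}) (P : I -> 'M[K]_n) (z : gT).
Hypothesis Hz : z \in H.
Hypothesis PP : forall i, P i *m P i = P i.
Hypothesis P0 : forall i j, i != j -> P i *m P j = 0.
Hypothesis Pz : forall i, P i *m rH z = rH z *m P (s i).
Hypothesis sN : (s ^+ N)%g = 1%g.

Let sO i : porbit s (s i) = porbit s i := porbit_perm s 1 i.

Let Q (O : {set I}) : 'M[K]_n := \sum_(i | porbit s i == O) P i.

Let QE O : Q O = \sum_i (if porbit s i == O then P i else 0).
Proof. by rewrite /Q big_mkcond. Qed.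

Let PQ i O : P i *m Q O = if porbit s i == O then P i else 0.
Proof.
rewrite QE mulmx_sumr (bigD1 i) //= big1 ?addr0 => [|j ne_ji].
  by case: ifP; rewrite ?mulmx0.
by case: ifP => _; rewrite ?mulmx0 // P0 // eq_sym.
Qed.

Let Qcomm O : Q O *m rH z = rH z *m Q O.
Proof.
rewrite /Q mulmx_suml mulmx_sumr [RHS](reindex_perm s) /=.
apply: eq_big => [i|i _]; last exact: Pz.
by rewrite sO.
Qed.

Let QQ O : Q O *m Q O = Q O.
Proof. by rewrite {1}/Q mulmx_suml; apply: eq_bigr => i iO; rewrite PQ iO. Qed.

Let Q0 O1 O2 : O1 != O2 -> Q O1 *m Q O2 = 0.
Proof.
move=> neO; rewrite {1}/Q mulmx_suml big1 // => i /eqP iO.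
by rewrite PQ iO (negPf neO).
Qed.

(** Weighting the blocks of a cycle of length [l] by successive powers of a primitive [l]-th root of
    unity gives an operator that shifts the exponents of [z] by [c = N %/ l]. The spectrum is
    invariant under this shift, so the character equals [zeta ^+ c] times itself, with
    [zeta ^+ c != 1]. *)
Let brauer_cycle i0 : s i0 != i0 -> brauer (Q (porbit s i0)) z = 0.
Proof.
move=> nfix; set O := porbit s i0; pose l := #|O|.
have l_gt1 : (l > 1)%N.
  apply/card_gt1P; exists i0, (s i0); split; rewrite ?porbit_id //; last by rewrite eq_sym.
  exact: (mem_porbit s 1).
have l_dv_N : (l %| N)%N.
  apply: (@dvdn_trans #[s]); last by rewrite order_dvdn sN.
  by rewrite /l /O porbit.unlock dvdn_orbit.
pose c := (N %/ l)%N; have cl : (c * l)%N = N by rewrite divnK.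
(* [t i] is the position of [i] in the cycle started at [i0]; applying [s] raises it by 1 modulo
   [l]. *)
pose t i := index i (traject s i0 l).
have tP i : porbit s i == O -> i = iter (t i) s i0 /\ (t i < l)%N.
  rewrite eq_porbit_mem porbit_traject -/l => Oi.
  have lt_t : (t i < l)%N by rewrite /t -{2}(size_traject s i0 l) index_mem.
  by split=> //; rewrite -(nth_traject s lt_t) nth_index.
have ts i : porbit s i == O -> (t (s i) = (t i).+1 %[mod l])%N.
  move=> Oi; have [Di lt_i] := tP i Oi.
  have Osi : porbit s (s i) == O by rewrite sO.
  have [Dsi lt_si] := tP _ Osi.
  have [lt1 | le1] := ltnP (t i).+1 l.
    congr (_ %% _)%N; apply/eqP.
    rewrite -(nth_uniq i0 _ _ (uniq_traject_porbit s i0)) ?size_traject //.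
    by rewrite !nth_traject // -Dsi iterS -Di.
  have t1 : (t i).+1 = l by apply/eqP; rewrite eqn_leq lt_i.
  rewrite t1 modnn.
  suff -> : t (s i) = 0%N by rewrite mod0n.
  apply/eqP; rewrite -(nth_uniq i0 _ _ (uniq_traject_porbit s i0)) ?size_traject //; last first.
    exact: ltnW.
  rewrite !nth_traject ?(ltnW l_gt1) // -Dsi {1}Di -iterS t1 /=.
  by rewrite /l iter_porbit.
pose T (f : nat -> K) := \sum_(i | porbit s i == O) f (t i) *: P i.
have TM f g : T f *m T g = T (fun j => f j * g j).
  rewrite /T mulmx_suml; apply: eq_bigr => i Oi; rewrite -scalemxAl mulmx_sumr.
  rewrite (bigD1 i) //= big1 ?addr0 => [|j /andP[_ ne_ji]].
    by rewrite -scalemxAr scalerA PP.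
  by rewrite -scalemxAr P0 ?scaler0 // eq_sym.
have T1 f : (forall j, f j = 1) -> T f = Q O.
  by move=> f1; apply: eq_bigr => i _; rewrite f1 scale1r.
have TQ f : T f *m Q O = T f.
  rewrite -(T1 (fun=> 1)) // TM; apply: eq_bigr => i _; by rewrite mulr1.
(* [A'] inverts [A] on the image of [Q O], so that each of the two ranks compared below bounds the
   other. *)
pose A := T (fun j => w ^+ (c * j)); pose A' := T (fun j => w ^- (c * j)).
have A'A : A' *m A = Q O by rewrite TM T1 // => j; rewrite mulVf ?expf_neq0.
have AA' : A *m A' = Q O by rewrite TM T1 // => j; rewrite divff ?expf_neq0.
have Az : A *m rH z = (w ^- c) *: (rH z *m A).
  rewrite /A /T mulmx_suml mulmx_sumr [in RHS](reindex_perm s) /= scaler_sumr.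
  rewrite [RHS](eq_bigl (fun i => porbit s i == O)) => [|i]; last first.
    by rewrite sO.
  apply: eq_bigr => i Oi; rewrite -scalemxAl -scalemxAr scalerA Pz; congr (_ *: _).
  apply: (mulfI (expf_neq0 c w_neq0)); rewrite mulrA divff ?expf_neq0 // mul1r -exprD -mulnS.
  apply/eqP; rewrite (eq_prim_root_expr prim_w) -cl -!muln_modr; apply/eqP.
  by rewrite (ts i Oi).
have Ae a : A *m eig z a = eig z (a + c) *m A by exact: eigproj_comm_mul.
have Qe a : Q O *m eig z a = eig z a *m Q O by apply: eigproj_comm => //; exact: Qcomm.
have br : brauer (Q O) z = zeta ^+ c * brauer (Q O) z.
  apply: brauer_shift => a; apply/eqP; rewrite eqn_leq; apply/andP; split.
    have -> : Q O *m eig z (a + c) = A *m (Q O *m eig z a) *m A'.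
      by rewrite [A *m _]mulmxA TQ Ae -mulmxA AA' Qe.
    by rewrite (leq_trans (mxrankM_maxl _ _)) // mxrankM_maxr.
  have -> : Q O *m eig z a = A' *m (Q O *m eig z (a + c)) *m A.
    by rewrite [A' *m _]mulmxA TQ -mulmxA -Ae mulmxA A'A.
  by rewrite (leq_trans (mxrankM_maxl _ _)) // mxrankM_maxr.
have c_ne1 : 1 - zeta ^+ c != 0.
  rewrite subr_eq0 eq_sym -(expr0 zeta) (eq_prim_root_expr prim_zeta) mod0n modn_small.
    by rewrite -lt0n; case: (c) cl N_gt0 => // <-.
  by rewrite -cl ltn_Pmulr // lt0n; case: (c) cl N_gt0 => // <-.
by apply: (mulfI c_ne1); rewrite mulr0 mulrBl mul1r -br subrr.
Qed.

(** Group the blocks by cycles of [s]: nontrivial cycles contribute 0, and a trivial cycle is a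
    single fixed block. *)
Lemma brauer_block : brauer (\sum_i P i) z = \sum_(i | s i == i) brauer (P i) z.
Proof.
have -> : \sum_i P i = \sum_O Q O by rewrite (partition_big (porbit s) predT).
rewrite brauer_sum // [RHS](partition_big (porbit s) predT) //=; apply: eq_bigr => O _.
have [i0 /eqP DO | noO] := pickP (fun i => porbit s i == O); last first.
  rewrite big_pred0 => [|i]; last by rewrite noO andbF.
  rewrite /Q big_pred0 // /brauer big1 // => a _.
  by rewrite mul0mx mxrank0 mul0r.
have fixO i : porbit s i == O -> (s i == i) = (s i0 == i0).
  have gen x y : porbit s x == O -> porbit s y == O -> s x = x -> s y = y.
    move=> Ox Oy fx; suff -> : y = x by [].
    have : y \in porbit s x by rewrite -eq_porbit_mem (eqP Ox) eq_sym (eqP Oy).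
    case/porbitP=> t ->; elim: t => [|t IHt]; first by rewrite expg0 perm1.
    by rewrite expgS permM fx.
  by move=> Oi; apply/eqP/eqP; apply: gen; rewrite ?DO.
have [fix0 | nfix] := eqVneq (s i0) i0; last first.
  rewrite -DO brauer_cycle // big_pred0 // => i; apply/negbTE/andP=> [[fixi Oi]].
  by move: fixi; rewrite fixO -?DO ?(eqP Oi) ?DO // (negPf nfix).
have uniO i : (porbit s i == O) = (i == i0).
  apply/idP/eqP=> [Oi | ->]; last by rewrite DO.
  have : i \in porbit s i0 by rewrite -eq_porbit_mem (eqP Oi) DO.
  case/porbitP=> t ->; elim: t => [|t IHt]; first by rewrite expg0 perm1.
  by rewrite expgS permM fix0.
rewrite [RHS](big_pred1 i0) => [|i]; last first.
  by rewrite /= uniO; have [->|_] := eqVneq i i0; rewrite ?andbF // fix0 eqxx.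
by rewrite /Q (big_pred1 i0).
Qed.

End Block.
End BrauerChar.

(** * Brauer characters of fixed spaces as averages over cosets *)

Section Averaging.
Variables (K : fieldType) (gT : finGroupType) (H : {group gT}) (n : nat).
Variable rH : mx_representation K H n.
Variables (N : nat) (w : K) (zeta : algC).
Hypothesis dvdHN : (#|H| %| N)%N.
Hypothesis prim_w : N.-primitive_root w.
Hypothesis prim_zeta : N.-primitive_root zeta.

Let exponentN : {in H, forall x, (x ^+ N)%g = 1%g}.
Proof.
by move=> x Hx; apply/eqP; rewrite -order_dvdn (dvdn_trans (order_dvdG Hx)).
Qed.
Let N_gt0 : (N > 0)%N := prim_order_gt0 prim_w.
Let w_neq0 : w != 0.
Proof. by rewrite (prim_root_eq0 prim_w) -lt0n. Qed.

Local Notation eig := (eigproj rH N w).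
Local Notation brauer := (brauer_char rH N w zeta).

Definition average_mx (D : {set gT}) : 'M[K]_n := #|D|%:R^-1 *: \sum_(d in D) rH d.
Local Notation avgmx := average_mx.

Lemma card_sub_neq0 (D : {group gT}) : D \subset H -> #|D|%:R != 0 :> K.
Proof.
move=> sDH; have /dvdnP[k Dk] : (#|D| %| N)%N by rewrite (dvdn_trans (cardSg sDH)).
by have := prim_root_natf_neq0 prim_w; rewrite {1}Dk natrM mulf_eq0 negb_or => /andP[].
Qed.

Section LinProj.
Variable D : {group gT}.
Hypothesis sDH : D \subset H.

(** Recording the exponent of a root of unity lets a linear character with values in [algC] be read
    in [K] through [w]. The default 0 is never reached for a linear character at an element of
    [D]. *)
Definition linexp (i : Iirr D) (d : gT) : nat :=
  if [pick a : 'I_N | 'chi_i d == zeta ^+ a] is Some a then val a else 0%N.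

Lemma linexpP i d : 'chi_i \is a linear_char -> d \in D ->
  'chi_i d = zeta ^+ linexp i d.
Proof.
move=> lin_i Dd; rewrite /linexp; case: pickP => [a /eqP //|].
have /(prim_rootP prim_zeta)[a Da] : 'chi_i d ^+ N = 1.
  by rewrite -lin_charX // exponentN ?lin_char1 ?(subsetP sDH).
by move/(_ a); rewrite Da eqxx.
Qed.

Let wz (a b : nat) : (w ^+ a == w ^+ b) = (zeta ^+ a == zeta ^+ b).
Proof. by rewrite (eq_prim_root_expr prim_w) (eq_prim_root_expr prim_zeta). Qed.

Lemma linexpM i d e : 'chi_i \is a linear_char -> d \in D -> e \in D ->
  w ^+ linexp i (d * e)%g = w ^+ linexp i d * w ^+ linexp i e.
Proof.
move=> lin_i Dd De; apply/eqP; rewrite -exprD wz exprD.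
by rewrite -!linexpP ?groupM // lin_charM.
Qed.

Lemma linexp_eq i j d e : 'chi_i \is a linear_char -> 'chi_j \is a linear_char ->
  d \in D -> e \in D -> (w ^+ linexp i d == w ^+ linexp j e) = ('chi_i d == 'chi_j e).
Proof. by move=> lin_i lin_j Dd De; rewrite wz -!linexpP. Qed.

(** The projection onto the eigenspace of [D] for the reduction to [K] of a linear character. The
    value 0 at nonlinear characters lets the family be indexed by all of [Iirr D]. *)
Definition linproj (i : Iirr D) : 'M[K]_n :=
  if 'chi_i \is a linear_char then #|D|%:R^-1 *: \sum_(d in D) w ^- linexp i d *: rH d
  else 0.

Lemma linproj_eig i g : 'chi_i \is a linear_char -> g \in D ->
  linproj i *m rH g = w ^+ linexp i g *: linproj i.
Proof.
move=> lin_i Dg; rewrite /linproj lin_i -scalemxAl scalerA mulrC -scalerA.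
congr (_ *: _); rewrite mulmx_suml scaler_sumr [RHS](reindex_inj (mulIg g)) /=.
apply: eq_big => [d|d Dd]; first by rewrite groupMr.
rewrite linexpM // -scalemxAl -repr_mxM ?(subsetP sDH) // scalerA; congr (_ *: _).
by rewrite invfM mulrCA divff ?mulr1 ?expf_neq0.
Qed.

Let char_sum (f : gT -> K) g : g \in D -> f g != 1 ->
    {in D &, {morph f : x y / (x * y)%g >-> x * y}} ->
  \sum_(d in D) f d = 0.
Proof.
move=> Dg fg1 fM; apply: (mulfI (_ : f g - 1 != 0)); first by rewrite subr_eq0.
rewrite mulr0 mulrBl mul1r; apply/eqP; rewrite subr_eq0; apply/eqP.
rewrite mulr_sumr [RHS](reindex_inj (mulgI g)) /=.
by apply: eq_big => [d|d Dd]; rewrite ?groupMl ?fM.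
Qed.

Lemma linproj_mul i j : linproj i *m linproj j = if i == j then linproj i else 0.
Proof.
have [lin_i | nlin_i] := boolP ('chi_i \is a linear_char); last first.
  by rewrite /linproj (negPf nlin_i) mul0mx if_same.
have [lin_j | nlin_j] := boolP ('chi_j \is a linear_char); last first.
  case: eqP => [Dij | _]; first by rewrite -Dij lin_i in nlin_j.
  by rewrite {2}/linproj (negPf nlin_j) mulmx0.
rewrite {2}/linproj lin_j -scalemxAr mulmx_sumr.
pose f d := w ^+ linexp i d / w ^+ linexp j d.
transitivity (#|D|%:R^-1 *: ((\sum_(d in D) f d) *: linproj i)).
  rewrite scaler_suml; congr (_ *: _); apply: eq_bigr => d Dd.
  by rewrite -scalemxAr linproj_eig // scalerA mulrC.
have [Dij | ne_ij] := eqVneq i j.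
  rewrite (eq_bigr (fun=> 1)) => [|d _]; last by rewrite /f Dij divff ?expf_neq0.
  by rewrite sumr_const scalerA mulVf ?scale1r ?card_sub_neq0.
suff -> : \sum_(d in D) f d = 0 by rewrite scale0r scaler0.
have [d Dd ne_d] : exists2 d, d \in D & 'chi_i d != 'chi_j d.
  apply/exists_inP; apply: contraR ne_ij => /exists_inPn eq_ij.
  by apply/eqP/irr_inj/cfun_inP => d Dd; apply/eqP; rewrite -[_ == _]negbK eq_ij.
apply: (char_sum Dd) => [|x y Dx Dy].
  rewrite /f -(can_eq (mulfK (expf_neq0 (linexp j d) w_neq0))) divfK ?expf_neq0 // mul1r.
  by rewrite linexp_eq.
by rewrite /f !linexpM // invfM mulrACA.
Qed.

(** The coefficient of [rH d] involves a sum over the linear characters of [D]. On the derived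
    subgroup all terms are 1, and their number is its index; elsewhere, multiplying by a linear
    character nontrivial at [d] permutes the terms and forces the sum to vanish. *)
Lemma linproj_sum : \sum_i linproj i = avgmx D^`(1)%g.
Proof.
have nzD := card_sub_neq0 sDH.
have sD'D : D^`(1)%g \subset D := der_sub 1 D.
have D'H : D^`(1)%g \subset H := subset_trans sD'D sDH.
transitivity (#|D|%:R^-1 *: \sum_(d in D) (\sum_(i | 'chi[D]_i \is a linear_char) w ^- linexp i d) *: rH d).
  rewrite /linproj -big_mkcond /= -scaler_sumr exchange_big /=; congr (_ *: _).
  by apply: eq_bigr => d _; rewrite scaler_suml.
rewrite (bigID (mem D^`(1)%g)) /= [X in _ *: (_ + X)]big1 ?addr0 => [|d /andP[Dd D'd]].
  rewrite /avgmx -(Lagrange sD'D) natrM invfM -scalerA; congr (_ *: _).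
  rewrite scaler_sumr; apply: eq_big => [d|d /andP[Dd D'd]].
    by rewrite andb_idl // => /(subsetP sD'D).
  rewrite (eq_bigr (fun=> 1)) => [|i lin_i]; last first.
    have : w ^+ linexp i d == w ^+ linexp i 1%g.
      rewrite linexp_eq //; apply/eqP/cfker1; rewrite lin_irr_der1 in lin_i.
      exact: (subsetP lin_i).
    have : w ^+ linexp i 1%g == w ^+ 0 by rewrite wz -linexpP // lin_char1.
    by move/eqP-> => /eqP->; rewrite invr1.
  have idx0 : #|D : D^`(1)%g|%:R != 0 :> K.
    apply: contraNneq nzD => i0; by rewrite -(Lagrange sD'D) natrM i0 mulr0.
  rewrite sumr_const (eq_card (_ : _ =i [pred i | 'chi[D]_i \is a linear_char])) //.
  by rewrite card_lin_irr scalerA mulVf ?scale1r.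
suff -> : \sum_(i | 'chi[D]_i \is a linear_char) w ^- linexp i d = 0 by rewrite scale0r.
move: D'd; rewrite -cap_cfker_lin_irr => /bigcapP D'd.
have [i0 lin0 ker0] : exists2 i, 'chi[D]_i \is a linear_char & d \notin cfker 'chi_i.
  apply/exists_inP; apply: contra_notT D'd => /exists_inPn D'd i /D'd.
  by rewrite negbK.
have ne1 : w ^- linexp i0 d != 1.
  apply: contra ker0; rewrite invr_eq1 -(expr0 w) wz -linexpP // expr0 => /eqP chi1.
  by rewrite cfkerEirr inE chi1 lin_char1.
have nz_i0 : 'chi_i0 \is a GRing.unit by apply: lin_char_unitr.
pose h (i : Iirr D) := cfIirr ('chi_i * 'chi_i0).
have hE i : 'chi_(h i) = 'chi_i * 'chi_i0.
  by rewrite /h cfIirrE // mulrC mul_lin_irr ?mem_irr.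
have h_inj : injective h.
  by move=> i j eq_h; apply/irr_inj/(mulIr nz_i0); rewrite -!hE eq_h.
apply: (mulfI (_ : w ^- linexp i0 d - 1 != 0)); first by rewrite subr_eq0.
rewrite mulr0 mulrBl mul1r; apply/eqP; rewrite subr_eq0; apply/eqP.
rewrite mulr_sumr [RHS](reindex_inj h_inj) /=.
apply: eq_big => [i|i lin_i].
  rewrite hE; apply/idP/idP => [lin_i | lin_i]; first exact: rpredM.
  by rewrite -['chi_i](mulrK nz_i0) rpredM // rpredV.
rewrite -invfM; congr (_^-1); apply/eqP; rewrite -exprD wz exprD -!linexpP //.
  by rewrite hE cfunE mulrC.
by rewrite hE rpredM.
Qed.

Lemma linproj_conj i z : z \in H -> z \in 'N(D) ->
  linproj i *m rH z = rH z *m linproj (conjg_Iirr i z).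
Proof.
move=> Hz nDz; rewrite /linproj conjg_IirrE.
have -> : (('chi_i ^ z)%CF \is a linear_char) = ('chi_i \is a linear_char).
  apply/idP/idP; last exact: cfConjg_lin_char.
  by move/(cfConjg_lin_char z^-1); rewrite cfConjgK.
case: ifP => lin_i; last by rewrite mul0mx mulmx0.
rewrite -scalemxAl -scalemxAr; congr (_ *: _); rewrite mulmx_suml mulmx_sumr.
rewrite [RHS](reindex_inj (conjg_inj z)) /=.
apply: eq_big => [d|d Dd]; first by rewrite memJ_norm.
have Hd := subsetP sDH d Dd.
rewrite -scalemxAl -scalemxAr -!repr_mxM ?groupJ // -conjgC; congr (_^-1 *: _).
have linz : 'chi_(conjg_Iirr i z) \is a linear_char.
  by rewrite conjg_IirrE cfConjg_lin_char.
apply/eqP; rewrite linexp_eq ?memJ_norm // conjg_IirrE.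
by rewrite cfConjgEJ.
Qed.

Lemma linproj0 : linproj 0 = avgmx D.
Proof.
have lin0 : 'chi[D]_0 \is a linear_char by rewrite irr0 cfun1_lin_char.
rewrite /linproj lin0; congr (_ *: _); apply: eq_bigr => d Dd.
have : w ^+ linexp 0 d == w ^+ 0 by rewrite wz -linexpP // irr0 cfun1E Dd.
by move/eqP->; rewrite invr1 scale1r.
Qed.

Lemma sum_irr i : \sum_(d in D) 'chi[D]_i d = (#|D| * (i == 0))%:R.
Proof.
have := cfdot_irr i 0 => /(congr1 ( *%R #|D|%:R)).
rewrite cfdotE mulrA divff ?neq0CG // mul1r -natrM => <-.
by apply: eq_bigr => d Dd; rewrite irr0 cfun1E Dd conjC1 mulr1.
Qed.

(** The fixed space of the derived subgroup splits into the eigenspaces of the linear characters of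
    [D], which [y * d] permutes as [y] does. Only those fixed by [y] count, each with a factor
    ['chi_i d], and summing over [d] leaves the trivial character. *)
Lemma brauer_avg_der1 y : y \in H -> y \in 'N(D) ->
  \sum_(d in D) brauer (avgmx D^`(1)%g) (y * d)%g = #|D|%:R * brauer (avgmx D) y.
Proof.
move=> Hy nDy; pose s i := perm (@conjg_Iirr_inj _ D i).
have sE d i : d \in D -> s (y * d)%g i = s y i.
  move=> Dd; rewrite !permE; apply: irr_inj; rewrite !conjg_IirrE.
  by have nDd := subsetP (normG D) d Dd; rewrite cfConjgMnorm // cfConjg_id.
have sN z : z \in H -> z \in 'N(D) -> (s z ^+ N)%g = 1%g.
  move=> Hz nDz; apply/permP => i; rewrite perm1.
  suff E t : (s z ^+ t)%g i = conjg_Iirr i (z ^+ t).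
    rewrite E exponentN //; apply: irr_inj; by rewrite conjg_IirrE cfConjgJ1.
  elim: t => [|t IHt]; apply: irr_inj.
    by rewrite expg0 perm1 conjg_IirrE cfConjgJ1.
  rewrite expgSr permM IHt permE !conjg_IirrE expgSr cfConjgMnorm //.
  by rewrite groupX.
transitivity (\sum_(d in D) \sum_(i | s y i == i) 'chi[D]_i d * brauer (linproj i) y).
  apply: eq_bigr => d Dd; have Hd := subsetP sDH d Dd.
  have nDd := subsetP (normG D) d Dd.
  have nDyd : (y * d)%g \in 'N(D) by apply: groupM.
  rewrite -linproj_sum (brauer_block exponentN prim_w prim_zeta (s := s (y * d)%g)).
  - apply: eq_big => [i|i /eqP fix_i]; first by rewrite sE.
    rewrite sE // in fix_i.
    have [lin_i | nlin_i] := boolP ('chi_i \is a linear_char); last first.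
      rewrite /linproj (negPf nlin_i) /brauer_char !big1 ?mulr0 // => a _;
        by rewrite mul0mx mxrank0 mul0r.
    rewrite (brauer_scal prim_w prim_zeta Hy Hd _ (linproj_eig lin_i Dd)).
      by rewrite -linexpP.
    by rewrite linproj_conj //; congr (_ *m linproj _); rewrite -[RHS]fix_i permE.
  - by rewrite groupM.
  - by move=> i; rewrite linproj_mul eqxx.
  - by move=> i j ne_ij; rewrite linproj_mul (negPf ne_ij).
  - by move=> i; rewrite linproj_conj ?permE // groupM.
  - by rewrite sN // groupM.
rewrite exchange_big /=.
transitivity (\sum_(i | s y i == i) (#|D| * (i == 0))%:R * brauer (linproj i) y).
  by apply: eq_bigr => i _; rewrite -mulr_suml sum_irr.
have fix0 : s y 0 == 0 by rewrite permE conjg_Iirr0.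
rewrite (bigD1 (0 : Iirr D)) //= big1 ?addr0 => [|i /andP[_ /negPf->]].
  by rewrite /= muln1 linproj0.
by rewrite muln0 mul0r.
Qed.

End LinProj.

Lemma avgmx1 : avgmx 1%g = 1%:M.
Proof. by rewrite /avgmx cards1 invr1 scale1r big_set1 repr_mx1. Qed.

(** This expresses the character of the fixed space of [D], a module for the normalizer only, by
    values of the character of the whole module of [H]. The induction goes through the derived
    subgroup. *)
Theorem brauer_avg (D : {group gT}) y : D \subset H -> solvable D ->
    y \in H -> y \in 'N(D) ->
  \sum_(d in D) brauer 1%:M (y * d)%g = #|D|%:R * brauer (avgmx D) y.
Proof.
have [m] := ubnP #|D|; elim: m D y => // m IHm D y /ltnSE-leDm sDH solD Hy nDy.
have [D1 | ntD] := eqVneq (D : {set gT}) 1%g.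
  by rewrite D1 big_set1 mulg1 cards1 mul1r avgmx1.
have sD'D : D^`(1)%g \subset D := der_sub 1 D.
have prD' : D^`(1)%g \proper D by apply: (sol_der1_proper solD).
rewrite -brauer_avg_der1 //.
have nzD' : #|D^`(1)%g|%:R != 0 :> algC by rewrite pnatr_eq0 -lt0n cardG_gt0.
apply: (mulfI nzD'); rewrite !mulr_sumr.
(* Each element of the coset of [y] is hit once for every [e] in the derived subgroup, and the
   induction hypothesis at [y * d] evaluates the inner sum. *)
transitivity (\sum_(d in D) \sum_(e in D^`(1)%g) brauer 1%:M (y * d * e)%g).
  rewrite exchange_big -mulr_sumr mulr_natl -sumr_const /=.
  apply: eq_bigr => e D'e; rewrite (reindex_inj (mulIg e)) /=.
  have De := subsetP sD'D e D'e.
  by apply: eq_big => [d | d _]; rewrite ?groupMr ?mulgA.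
apply: eq_bigr => d Dd; rewrite IHm //.
- by rewrite (leq_trans (proper_card prD')).
- by rewrite (subset_trans sD'D).
- by rewrite (solvableS sD'D).
- by rewrite groupM // (subsetP sDH).
- apply: (subsetP (char_norms (der_char 1 D))).
  by have nDd := subsetP (normG D) d Dd; apply: groupM.
Qed.

End Averaging.

(** * Fourier inversion and Galois-stable spectra *)

Section Rationality.
Variables (K : fieldType) (gT : finGroupType) (H : {group gT}) (n : nat).
Variable rH : mx_representation K H n.
Variables (N : nat) (w : K) (zeta : algC).
Hypothesis dvdHN : (#|H| %| N)%N.
Hypothesis prim_w : N.-primitive_root w.
Hypothesis prim_zeta : N.-primitive_root zeta.

Let exponentN : {in H, forall x, (x ^+ N)%g = 1%g}.
Proof.
by move=> x Hx; apply/eqP; rewrite -order_dvdn (dvdn_trans (order_dvdG Hx)).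
Qed.
Let N_gt0 : (N > 0)%N := prim_order_gt0 prim_w.

Local Notation eig := (eigproj rH N w).
Local Notation brauer := (brauer_char rH N w zeta).
Local Notation avgmx := (average_mx rH).

(** The image of [P] splits into the pieces [Q a], on which [z ^+ t] acts as the scalar
    [w ^+ (a * t)]. *)
Lemma brauerX P z (t : nat) : z \in H -> P *m P = P -> P *m rH z = rH z *m P ->
  brauer P (z ^+ t)%g = \sum_(a < N) (\rank (P *m eig z a))%:R * zeta ^+ (a * t).
Proof.
move=> Hz PP Pz; pose Q (a : 'I_N) := P *m eig z a.
have Pe a : P *m eig z a = eig z a *m P by apply: eigproj_comm.
have ez a : eig z a *m rH z = rH z *m eig z a.
  by apply/esym/eigproj_comm.
have QQ a b : Q a *m Q b = if a == b then Q a else 0.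
  rewrite /Q [in X in _ *m X]Pe mulmxA -[P *m _ *m _]mulmxA eigproj_mul // !modn_small // eq_sym.
  by rewrite -val_eqE; case: ifP => _; rewrite ?mulmx0 ?mul0mx // -mulmxA -Pe mulmxA PP.
have QX a s : Q a *m rH (z ^+ s)%g = w ^+ (a * s) *: Q a.
  elim: s => [|s IHs]; first by rewrite muln0 expg0 scale1r repr_mx1 mulmx1.
  rewrite expgSr repr_mxM ?groupX // mulmxA IHs -scalemxAl -mulmxA eigproj_eig //.
  by rewrite -scalemxAr scalerA mulnS addnC exprD.
have DP : P = \sum_a Q a by rewrite /Q -mulmx_sumr eigproj_sum ?mulmx1.
rewrite {1}DP (brauer_sum zeta exponentN prim_w) ?groupX //.
- apply: eq_bigr => a _; have lt_at := ltn_pmod (a * t) N_gt0.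
  rewrite -(prim_expr_mod prim_zeta) /brauer_char (bigD1 (Ordinal lt_at)) //=.
  have Qe c : Q a *m eig (z ^+ t)%g c = if (c == (a * t)%N %[mod N])%N then Q a else 0.
    rewrite (eigproj_scalar prim_w c (b := Ordinal lt_at)) ?groupX //= ?modn_mod //.
    by rewrite prim_expr_mod // QX.
  rewrite Qe modn_mod eqxx big1 ?addr0 // => c ne_c; rewrite Qe ifN ?mxrank0 ?mul0r //.
  by apply: contra ne_c; rewrite -val_eqE /= modn_small.
- by move=> a; rewrite QQ eqxx.
- by move=> a b /negPf ne_ab; rewrite QQ ne_ab.
- move=> a; rewrite QX /Q Pe mulmxA.
  have -> : rH (z ^+ t)%g *m eig z a = w ^+ (a * t) *: eig z a.
    have -> : rH (z ^+ t)%g *m eig z a = eig z a *m rH (z ^+ t)%g.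
      elim: t {QX} => [|s IHs]; first by rewrite expg0 repr_mx1 mulmx1 mul1mx.
      by rewrite expgSr repr_mxM ?groupX // -mulmxA -ez mulmxA IHs mulmxA.
    elim: t => [|s IHs]; first by rewrite muln0 expg0 scale1r repr_mx1 mulmx1.
    rewrite expgSr repr_mxM ?groupX // mulmxA IHs -scalemxAl eigproj_eig //.
    by rewrite scalerA mulnS addnC exprD.
  exact: scalemxAl.
Qed.

Lemma eigproj_mod z a : eig z (a %% N) = eig z a.
Proof.
rewrite /eigproj; congr (_ *: _); apply: eq_bigr => t _.
by rewrite !exprM (prim_expr_mod prim_w).
Qed.

Lemma rank_eig_inversion P z b : z \in H -> P *m P = P -> P *m rH z = rH z *m P ->
  N%:R * (\rank (P *m eig z b))%:R = \sum_(t < N) zeta ^- (b * t) * brauer P (z ^+ t)%g.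
Proof.
move=> Hz PP Pz; transitivity (\sum_(a < N) \sum_(t < N)
    (zeta ^- (b * t) * zeta ^+ (a * t)) * (\rank (P *m eig z a))%:R).
  have lt_b := ltn_pmod b N_gt0; rewrite (bigD1 (Ordinal lt_b)) //= [X in _ + X]big1 ?addr0.
    by rewrite -mulr_suml (sum_unity_root prim_zeta) modn_mod eqxx mul1r eigproj_mod.
  move=> a ne_a; rewrite -mulr_suml (sum_unity_root prim_zeta).
  rewrite (_ : (b == a %[mod N])%N = false) ?mul0r //.
  by apply: contraNF ne_a; rewrite -val_eqE /= eq_sym [(a %% N)%N]modn_small.
rewrite exchange_big /=; apply: eq_bigr => t _; rewrite brauerX // mulr_sumr.
by apply: eq_bigr => a _; rewrite -mulrA; congr (_ * _); rewrite mulrC.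
Qed.

Lemma brauer_aut P z j (u : {rmorphism algC -> algC}) : z \in H ->
    coprime j N -> u zeta = zeta ^+ j -> P *m P = P -> P *m rH z = rH z *m P ->
  brauer P (z ^+ j)%g = u (brauer P z).
Proof.
move=> Hz co_jN uz PP Pz; rewrite brauerX // rmorph_sum; apply: eq_bigr => a _.
by rewrite rmorphM rmorph_nat rmorphXn uz -exprM mulnC.
Qed.

Lemma avgmx_mull (B : {group gT}) b : B \subset H -> b \in B ->
  rH b *m avgmx B = avgmx B.
Proof.
move=> sBH Bb; rewrite /average_mx -scalemxAr; congr (_ *: _).
rewrite mulmx_sumr [RHS](reindex_inj (mulgI b)) /=.
apply: eq_big => [x | x Bx]; first by rewrite groupMl.
by rewrite repr_mxM ?(subsetP sBH).
Qed.

Lemma avgmx_idem (B : {group gT}) : B \subset H -> avgmx B *m avgmx B = avgmx B.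
Proof.
move=> sBH; rewrite {1}/average_mx -scalemxAl mulmx_suml.
rewrite (eq_bigr (fun=> avgmx B)) => [|b Bb]; last exact: avgmx_mull.
by rewrite sumr_const -scaler_nat scalerA mulVf ?scale1r // (card_sub_neq0 dvdHN prim_w).
Qed.

Lemma avgmx_comm (B : {group gT}) y : B \subset H -> y \in H -> y \in 'N(B) ->
  avgmx B *m rH y = rH y *m avgmx B.
Proof.
move=> sBH Hy nBy; rewrite /average_mx -scalemxAl -scalemxAr; congr (_ *: _).
rewrite mulmx_suml mulmx_sumr [RHS](reindex_inj (conjg_inj y)) /=.
apply: eq_big => [x | x Bx]; first by rewrite memJ_norm.
have Hx := subsetP sBH x Bx.
by rewrite -!repr_mxM ?groupJ // -conjgC.
Qed.

Lemma avgmx_mulr (B : {group gT}) b : B \subset H -> b \in B ->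
  avgmx B *m rH b = avgmx B.
Proof.
move=> sBH Bb; rewrite avgmx_comm ?avgmx_mull ?(subsetP sBH) //.
by rewrite (subsetP (normG B)).
Qed.

Lemma avgmx_rfix (B : {group gT}) : B \subset H -> (avgmx B :=: rfix_mx rH B)%MS.
Proof.
move=> sBH; apply/eqmxP/andP; split.
  by apply/rfix_mxP => b Bb; apply: avgmx_mulr.
apply/submxP; exists (rfix_mx rH B); rewrite /average_mx -scalemxAr mulmx_sumr.
rewrite (eq_bigr (fun=> rfix_mx rH B)) => [|b Bb]; last exact: (rfix_mxP B _ _).
by rewrite sumr_const -scaler_nat scalerA mulVf ?scale1r // (card_sub_neq0 dvdHN prim_w).
Qed.

(** The automorphism [u] taking [zeta] to [zeta ^+ j] fixes the Brauer character of the whole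
    module, since [z ^+ j] and [z] are conjugate in [H]. By [brauer_avg] it also fixes that of the
    fixed space of [B], although the conjugating elements need not normalize [B]. Fourier inversion
    then gives equal multiplicities. *)
Theorem rank_eig_rational (B : {group gT}) y (j b : nat) :
    B \subset H -> solvable B -> y \in H -> y \in 'N(B) -> coprime j N ->
    (forall z, z \in H -> (z ^+ j)%g \in z ^: H) ->
  \rank (avgmx B *m eig y (j * b)) = \rank (avgmx B *m eig y b).
Proof.
move=> sBH solB Hy nBy co_jN ratH.
have [u uE] := Qn_aut_exists co_jN.
have uz : u zeta = zeta ^+ j by rewrite uE ?(prim_expr_order prim_zeta).
have idB := avgmx_idem sBH.
have br1 z : z \in H -> u (brauer 1%:M z) = brauer 1%:M z.
  move=> Hz; rewrite -(@brauer_aut _ _ j) ?mulmx1 ?mul1mx //.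
  have /imsetP[g Hg ->] := ratH z Hz.
  have := brauerJ rH N w zeta 1%:M Hz Hg.
  by rewrite mulmx1 -repr_mxM ?groupV // mulVg repr_mx1 => ->.
have brB z : z \in H -> z \in 'N(B) -> u (brauer (avgmx B) z) = brauer (avgmx B) z.
  move=> Hz nBz; have nzB : #|B|%:R != 0 :> algC by rewrite pnatr_eq0 -lt0n cardG_gt0.
  apply: (mulfI nzB); rewrite -{1}[#|B|%:R](rmorph_nat u) -rmorphM -brauer_avg // rmorph_sum.
  by apply: eq_bigr => d Bd; rewrite br1 // groupM // (subsetP sBH).
apply/eqP; rewrite -(eqr_nat algC); apply/eqP.
have nzN : N%:R != 0 :> algC by rewrite pnatr_eq0 -lt0n.
have com t : avgmx B *m rH (y ^+ t)%g = rH (y ^+ t)%g *m avgmx B.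
  by rewrite avgmx_comm ?groupX.
apply: (mulfI nzN); rewrite rank_eig_inversion ?avgmx_comm //.
transitivity (u (N%:R * (\rank (avgmx B *m eig y b))%:R)); last by rewrite -natrM rmorph_nat.
rewrite rank_eig_inversion ?avgmx_comm // rmorph_sum; apply: eq_bigr => t _.
rewrite rmorphM brB ?groupX //; congr (_ * _).
by rewrite fmorphV rmorphXn uz -exprM mulnA.
Qed.

Lemma rank_eig_sum (B : {group gT}) y : B \subset H -> y \in H -> y \in 'N(B) ->
  (\sum_(a < N) \rank (avgmx B *m eig y a) = \rank (rfix_mx rH B))%N.
Proof.
move=> sBH Hy nBy; have idB := avgmx_idem sBH.
have com a : avgmx B *m eig y a = eig y a *m avgmx B.
  by apply: eigproj_comm; rewrite ?avgmx_comm.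
rewrite -(avgmx_rfix sBH) -mxrank_sum_orth_idem.
- by rewrite -mulmx_sumr eigproj_sum ?mulmx1.
- move=> a; rewrite [in X in _ *m X]com mulmxA -[_ *m _ *m eig y a]mulmxA eigproj_mul //.
  by rewrite eqxx -mulmxA -com mulmxA idB.
- move=> a b ne_ab; rewrite [in X in _ *m X]com mulmxA -[_ *m _ *m eig y b]mulmxA eigproj_mul //.
  by rewrite !modn_small // eq_sym val_eqE (negPf ne_ab) mulmx0 mul0mx.
Qed.

Lemma eigproj_cap (B : {group gT}) y a : B \subset H -> y \in H -> y \in 'N(B) ->
  (avgmx B *m eig y a :=: rfix_mx rH B :&: eigenspace (rH y) (w ^+ a))%MS.
Proof.
move=> sBH Hy nBy; have idB := avgmx_idem sBH.
have com : avgmx B *m eig y a = eig y a *m avgmx B.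
  by apply: eigproj_comm; rewrite ?avgmx_comm.
apply/eqmxP/andP; split.
  rewrite sub_capmx -(avgmx_rfix sBH) {1}com submxMl /=; apply/eigenspaceP.
  by rewrite -mulmxA eigproj_eig // scalemxAr.
set X := (_ :&: _)%MS.
have Xfix b : b \in B -> X *m rH b = X by move=> Bb; apply: (rfix_mxP B _ _); rewrite ?capmxSl.
have Xavg : X *m avgmx B = X.
  rewrite /average_mx -scalemxAr mulmx_sumr (eq_bigr (fun=> X)) //.
  by rewrite sumr_const -scaler_nat scalerA mulVf ?scale1r // (card_sub_neq0 dvdHN prim_w).
have lt_a := ltn_pmod a N_gt0.
have Xeig : X *m eig y a = X.
  rewrite (eigproj_scalar prim_w a (b := Ordinal lt_a)) //= ?modn_mod ?eqxx //.
  by rewrite (prim_expr_mod prim_w); apply/eigenspaceP; rewrite capmxSr.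
by apply/submxP; exists X; rewrite mulmxA Xavg Xeig.
Qed.

End Rationality.

(** * Galois orbits of exponents *)

(** The cofactor [i] is the index of [L <*> C] in [A]. As [C] need not lie in [L], [#|L : C|] is the
    index in [L] of the intersection. *)
Lemma abelian_index_cap (aT : finGroupType) (A L C : {group aT}) :
    abelian A -> L \subset A -> C \subset A ->
  exists2 i, (#|L : C| * i)%N = #|A : C| & (i %| #|A : L|)%N.
Proof.
move=> cAA sLA sCA; have cLC : C \subset 'N(L).
  by rewrite cents_norm // (subset_trans sCA) // (subset_trans cAA) // centS.
have sLCA : (L <*> C)%G \subset A by rewrite join_subG sLA.
exists #|A : (L <*> C)%G|; last by rewrite indexgS // joing_subl.
rewrite mulnC -[RHS](Lagrange_index sLCA (joing_subr L C)); congr (_ * _)%N.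
apply/eqP; rewrite -(eqn_pmul2l (cardG_gt0 (L :&: C)%G)) /=.
rewrite -[#|L : C|]indexgI Lagrange ?subsetIl //.
rewrite -(eqn_pmul2r (cardG_gt0 C)) -mulnA [(#|_ : C| * _)%N]mulnC Lagrange ?joing_subr //.
by rewrite /= norm_joinEr // mul_cardG mulnC.
Qed.

Lemma orbit_sum_dvd (aT : finGroupType) (rT : finType) (D : {group aT})
    (to : action D rT) (L : {group aT}) (S : {set rT}) (o : nat) (c : rT -> nat) :
    [acts L, on S | to] -> (forall x, x \in S -> #|orbit to L x| = o) ->
    (forall x j, x \in S -> j \in L -> c (to x j) = c x) ->
  (o %| \sum_(x in S) c x)%N /\ (forall x, x \in S -> c x * o <= \sum_(x in S) c x)%N.
Proof.
move=> actsL orbS cL.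
have sumO x : x \in S -> (\sum_(y in orbit to L x) c y = c x * o)%N.
  move=> Sx; rewrite (eq_bigr (fun=> c x)) => [|_ /orbitP[j Lj <-]]; last exact: cL.
  by rewrite sum_nat_const orbS // mulnC.
split; last first.
  move=> x Sx; rewrite -sumO // [leqRHS](bigID (mem (orbit to L x))) /=.
  rewrite [X in (_ <= X + _)%N](eq_bigl (mem (orbit to L x))) ?leq_addr // => y.
  by rewrite andb_idl // => /(subsetP _) -> //; rewrite acts_sub_orbit.
rewrite (set_partition_big _ (orbit_partition actsL)) /=.
by apply: dvdn_sum => _ /imsetP[x Sx ->]; rewrite sumO // dvdn_mull.
Qed.

(** Chinese remainders: [b] is [a] modulo [n] and 1 modulo the part of [Q] prime to [n]. *)
Lemma coprime_lift (Q n a : nat) : (0 < Q)%N -> (n %| Q)%N -> coprime a n ->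
  exists2 b, coprime b Q & b = a %[mod n].
Proof.
move=> Q_gt0 dv_nQ co_an.
have n_gt0 : (0 < n)%N := dvdn_gt0 Q_gt0 dv_nQ.
have [n1 | n_neq1] := eqVneq n 1%N.
  by exists 1%N; rewrite ?coprime1n // n1 !modn1.
pose Q' := (Q`_(\pi(n)^'))%N.
have co_nQ' : coprime n Q'.
  by rewrite (@pnat_coprime \pi(n)) ?pnat_pi ?part_pnat.
pose b := chinese n Q' a 1; exists b; last by rewrite chinese_modl.
have co_bn : coprime b n by rewrite -coprime_modl chinese_modl // coprime_modl.
have co_bQ' : coprime b Q' by rewrite -coprime_modl chinese_modr // coprime_modl coprime1n.
have b_gt0 : (0 < b)%N.
  by case: (b) co_bn => //; rewrite /coprime gcd0n (negPf n_neq1).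
rewrite -(partnC \pi(n) Q_gt0) coprimeMr co_bQ' andbT coprime_sym.
rewrite (@pnat_coprime \pi(n)) ?part_pnat // -coprime_pi' //.
by rewrite coprime_sym.
Qed.

Section UnitAction.
Variable Q : nat.
Hypothesis Q_gt1 : (1 < Q)%N.
Local Notation uT := {unit 'Z_Q}.

Definition unat (j : uT) : nat := val (val j).

Lemma unat1 : unat 1%g = 1%N.
Proof. by rewrite /unat /= modn_small. Qed.

Lemma unatM (j k : uT) : unat (j * k)%g = (unat j * unat k %% Q)%N.
Proof. exact: (f_equal2 modn (erefl _) (Zp_cast Q_gt1)). Qed.

Lemma coprime_unat (j : uT) : coprime (unat j) Q.
Proof. by rewrite coprime_sym -unitZpE // natr_Zp; exact: (valP j). Qed.

Lemma unat_onto (a : nat) : coprime a Q -> {j : uT | unat j = a %[mod Q]}.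
Proof.
move=> co_aQ; have Ua : (a%:R : 'Z_Q) \is a GRing.unit by rewrite unitZpE // coprime_sym.
by exists (FinRing.unit _ Ua); rewrite /unat /= val_Zp_nat // modn_mod.
Qed.

Section Act.
Variables (N : nat) (N_gt0 : (0 < N)%N).
Hypothesis dvNQ : (N %| Q)%N.

(** Units modulo [Q] act on the exponents of [w] as Galois automorphisms act on the [N]-th roots of
    unity. *)
Definition expact (a : 'I_N) (j : uT) : 'I_N := Ordinal (ltn_pmod (a * unat j) N_gt0).

Lemma expact1 : expact^~ 1%g =1 id.
Proof. by move=> a; apply: val_inj; rewrite /= unat1 muln1 modn_small. Qed.

Lemma expactM a : act_morph expact a.
Proof.
move=> j k; apply: val_inj; rewrite /= unatM.
by rewrite modnMml -modnMmr modn_dvdm // modnMmr mulnA.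
Qed.

Canonical exp_action := TotalAction expact1 expactM.

Definition unit_mod1 (n : nat) : {set uT} := [set j | unat j == 1 %[mod n]].

(* [w ^+ a] has order [n] when [w] is a primitive [N]-th root of unity. *)
Definition exp_order (a n : nat) := forall t, (N %| a * t)%N = (n %| t)%N.

Lemma exp_stab (a : 'I_N) n : exp_order a n -> 'C[a | exp_action]%g = unit_mod1 n.
Proof.
move=> oa; apply/setP => j; rewrite !inE sub1set inE /= -val_eqE /=.
rewrite -[X in _ == X](modn_small (ltn_ord a)) -{2}[val a]muln1.
have j_gt0 : (0 < unat j)%N.
  have := coprime_unat j; case: (unat j) => //.
  by rewrite /coprime gcd0n; case: (Q) Q_gt1 => [|[]].
by rewrite !eqn_mod_dvd ?leq_mul2l ?j_gt0 ?orbT // -mulnBr oa.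
Qed.

Lemma exp_orderJ (a : 'I_N) j n : exp_order a n -> exp_order (expact a j) n.
Proof.
move=> oa t; rewrite /= [in LHS]/dvdn modnMml -/(dvdn _ _) mulnAC Gauss_dvdl ?oa //.
by rewrite coprime_sym (coprime_dvdr dvNQ) // coprime_unat.
Qed.

Lemma exp_orderP (a n : nat) : reflect (exp_order a n) (n == N %/ gcdn a N)%N.
Proof.
have g_gt0 : (0 < gcdn a N)%N by rewrite gcdn_gt0 N_gt0 orbT.
have gen t : (N %| a * t)%N = (N %/ gcdn a N %| t)%N.
  rewrite -{1}(divnK (dvdn_gcdr a N)) -{3}(divnK (dvdn_gcdl a N)) mulnAC.
  rewrite dvdn_pmul2r // Gauss_dvdr // /coprime -(eqn_pmul2r g_gt0) mul1n muln_gcdl.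
  by rewrite !divnK ?dvdn_gcdl ?dvdn_gcdr // gcdnC.
apply: (iffP eqP) => [-> // | oa]; apply/eqP; rewrite eqn_dvd.
by rewrite -oa gen dvdnn -gen oa dvdnn.
Qed.

End Act.

(** [unit_mod1 n] is the stabilizer of 1 in Z/n, whose orbit consists of all residues prime to [n]
    by [coprime_lift]. *)
Lemma index_unit_mod1 n : (n %| Q)%N -> #|[set: uT] : unit_mod1 n| = totient n.
Proof.
move=> dv_nQ; have n_gt0 : (0 < n)%N := dvdn_gt0 (ltnW Q_gt1) dv_nQ.
pose a1 : 'I_n := Ordinal (ltn_pmod 1 n_gt0).
have o1 : exp_order n a1 n by move=> t; rewrite /= /dvdn modnMml mul1n.
have := card_orbit (exp_action n_gt0 dv_nQ) [set: uT]%G a1.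
rewrite setTI (exp_stab _ _ o1) => <-.
rewrite totient_count_coprime big_mkord -sum1_card big_mkcond /=.
apply: eq_bigr => a _; rewrite (_ : (a \in _) = coprime n a); first by case: coprime.
apply/orbitP/idP => [[j _ <-] | co_na].
  by rewrite /= coprime_modr coprimeMr coprime_modr coprimen1 coprime_sym (coprime_dvdr dv_nQ) ?coprime_unat.
have [b co_bQ Db] := coprime_lift (ltnW Q_gt1) dv_nQ (etrans (coprime_sym _ _) co_na).
have [j Dj] := unat_onto co_bQ; exists j; rewrite ?inE //; apply: val_inj => /=.
by rewrite modnMml mul1n -(modn_dvdm _ dv_nQ) Dj modn_dvdm // Db modn_small.
Qed.

(** These exponents are the [N %/ n * t] with [t < n] prime to [n]. *)
Lemma card_exp_order N n : (0 < N)%N -> (n %| N)%N ->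
  #|[set a : 'I_N | n == N %/ gcdn a N]%N| = totient n.
Proof.
move=> N_gt0 dv_nN; have n_gt0 : (0 < n)%N := dvdn_gt0 N_gt0 dv_nN.
have c_gt0 : (0 < N %/ n)%N by rewrite divn_gt0 // dvdn_leq.
have lt_ct (t : 'I_n) : (N %/ n * t < N)%N.
  by rewrite -{2}(divnK dv_nN) ltn_pmul2l.
pose f (t : 'I_n) : 'I_N := Ordinal (lt_ct t).
have f_inj : injective f.
  by move=> t u /(congr1 val) /= /eqP; rewrite eqn_pmul2l // => /eqP/val_inj.
set c := (N %/ n)%N in c_gt0 lt_ct f f_inj; have DN : N = (c * n)%N by rewrite divnK.
have fE (t : 'I_n) : (n == N %/ gcdn (f t) N)%N = coprime n t.
  rewrite /= {1 2}DN -muln_gcdr divnMl // /coprime gcdnC.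
  have g_dv : (gcdn n t %| n)%N := dvdn_gcdl n t.
  apply/eqP/eqP=> [Dn | ->]; last by rewrite divn1.
  have := divnK g_dv; rewrite -Dn => ng.
  by apply/eqP; rewrite -(eqn_pmul2l n_gt0) muln1 ng.
rewrite totient_count_coprime big_mkord -sum1_card.
transitivity (#|f @: [set t : 'I_n | coprime n t]|).
  rewrite sum1_card; apply: eq_card => a; rewrite inE.
  apply/idP/imsetP=> [/eqP Dn | [t]]; last by rewrite inE => co_nt ->; rewrite fE.
  have c_dv_a : (c %| a)%N.
    suff -> : c = gcdn a N by rewrite dvdn_gcdl.
    apply/eqP; rewrite -(eqn_pmul2r n_gt0) -DN Dn mulnC divnK ?dvdn_gcdr //.
  have lt_t : (a %/ c < n)%N by rewrite ltn_divLR // mulnC -DN.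
  have Da : a = f (Ordinal lt_t) by apply: val_inj; rewrite /= mulnC divnK.
  by exists (Ordinal lt_t); rewrite // inE -fE -Da -Dn.
rewrite card_imset // -sum1dep_card big_mkcond /=.
by apply: eq_bigr => t _; case: coprime.
Qed.

(* In applications [c a] is the multiplicity of the eigenvalue [w ^+ a]; [o] is the size of the
   [L]-orbits on the exponents of order [n]. *)
Lemma exp_orbits (L : {group uT}) n : (n %| Q)%N ->
  exists o i : nat, [/\ (o * i)%N = totient n, (i %| #|[set: uT] : L|)%N &
   forall (N : nat) (N_gt0 : (0 < N)%N) (c : nat -> nat), (N %| Q)%N ->
     (forall a, a < N -> c a != 0 -> n == N %/ gcdn a N)%N ->
     (forall j a, j \in L -> (a < N)%N -> c (a * unat j %% N)%N = c a) ->
     (o %| \sum_(a < N) c a)%N /\ (forall a, (a < N)%N -> c a * o <= \sum_(a < N) c a)%N].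
Proof.
move=> dv_nQ; have n_gt0 : (0 < n)%N := dvdn_gt0 (ltnW Q_gt1) dv_nQ.
pose a1 : 'I_n := Ordinal (ltn_pmod 1 n_gt0).
have o1 : exp_order n a1 n by move=> t; rewrite /= /dvdn modnMml mul1n.
pose C := 'C_[set: uT][a1 | exp_action n_gt0 dv_nQ]%G.
have DC : C = unit_mod1 n :> {set uT} by rewrite /= setTI (exp_stab _ _ o1).
have [i Di dv_i] := @abelian_index_cap _ [set: uT]%G L C (units_Zp_abelian Q) (subsetT _) (subsetT _).
(* For every [N], an exponent of order [n] has stabilizer [unit_mod1 n], so that all [L]-orbits on
   such exponents have this same size. *)
exists #|L : C|, i; split=> //; first by rewrite Di DC index_unit_mod1.
move=> N N_gt0 c dvNQ suppc cL; pose S := [set a : 'I_N | n == N %/ gcdn a N]%N.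
have sumS : (\sum_(a < N) c a = \sum_(a in S) c a)%N.
  rewrite (bigID (mem S)) /= [X in (_ + X)%N]big1 ?addn0 // => a; rewrite inE => nSa.
  by apply/eqP; apply: contraR nSa => /(suppc _ (ltn_ord a)).
have actsL : [acts L, on S | exp_action N_gt0 dvNQ].
  apply/subsetP => j _; rewrite !inE; apply/subsetP => a; rewrite !inE => /(exp_orderP N_gt0) oa.
  by apply/(exp_orderP N_gt0); apply: (exp_orderJ N_gt0 dvNQ j oa).
have [||dvS leS] := @orbit_sum_dvd _ _ _ (exp_action N_gt0 dvNQ) L S #|L : C| c actsL.
- move=> a; rewrite inE => /(exp_orderP N_gt0) oa.
  by rewrite card_orbit (exp_stab _ _ oa) -DC indexgI.
- by move=> a j _ Lj; apply: (cL j a Lj (ltn_ord a)).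
rewrite sumS; split=> // a lt_a.
have [-> //| ca_neq0] := eqVneq (c a) 0%N.
by apply: (leS (Ordinal lt_a)); rewrite inE suppc.
Qed.

End UnitAction.

(** * Spectra on fixed points in elementary abelian groups *)

Lemma closed_prim_root_exists (K : closedFieldType) n :
  n%:R != 0 :> K -> {z : K | n.-primitive_root z}.
Proof.
move=> nzn; have n_gt0 : (0 < n)%N by rewrite lt0n; apply: contraNneq nzn => ->.
pose q : {poly K} := 'X^n - 1; have [r Dq] := closed_field_poly_normal q.
apply/sigW; rewrite (monicP _) ?monicXnsubC // scale1r in Dq.
have rn1: all n.-unity_root r by apply/allP=> z; rewrite -root_prod_XsubC -Dq.
have sz_r: (n < (size r).+1)%N.
  by rewrite -(size_prod_XsubC r id) -Dq size_XnsubC.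
have [|z] := hasP (has_prim_root n_gt0 rn1 _ sz_r); last by exists z.
by rewrite -separable_prod_XsubC -Dq separable_Xn_sub_1.
Qed.

(** The [p.-1] nonzero elements of the prime field already exhaust the roots of X^(p-1) - 1 in
    [K]. *)
Lemma unity_root_natr (p : nat) (K : fieldType) (f : {rmorphism 'F_p -> K}) (c : K) :
  prime p -> c ^+ p.-1 = 1 -> exists k : nat, c = k%:R.
Proof.
move=> p_pr c1; have p_gt1 := prime_gt1 p_pr; have p_gt0 := prime_gt0 p_pr.
pose rs := [seq f x | x <- enum (predC1 (0 : 'F_p))].
have u_rs : uniq rs by rewrite (map_inj_uniq (fmorph_inj f)) enum_uniq.
have sz_rs : size rs = p.-1.
  by rewrite size_map -cardE cardC1 card_Fp.
have rs1 : all (p.-1).-unity_root rs.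
  apply/allP => c' /mapP[x + ->]; rewrite mem_enum => nz_x.
  rewrite unity_rootE -rmorphXn (_ : x ^+ _ = 1) ?rmorph1 //.
  have xp : x ^+ p = x by rewrite -[RHS]expf_card card_Fp.
  by apply: (mulfI nz_x); rewrite -exprS prednK // xp mulr1.
have : c \in rs.
  have p1_gt0 : (0 < p.-1)%N by rewrite -subn1 subn_gt0.
  apply/negPn/negP => c_rs.
  have : (size (c :: rs) <= p.-1)%N.
    apply: max_unity_roots => //; last by rewrite /= c_rs.
    by rewrite /= rs1 andbT unity_rootE c1.
  by rewrite /= sz_rs ltnn.
case/mapP => x _ ->; exists (x : nat).
by rewrite -(rmorph_nat f) natr_Zp.
Qed.

Section Spectrum.
Variables (gT : finGroupType) (p N : nat) (V H : {group gT}).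
Hypotheses (p_pr : prime p) (abelV : p.-abelem V) (ntV : V :!=: 1%g).
Hypotheses (nVH : H \subset 'N(V)) (dvdHN : (#|H| %| N)%N) (p'N : ~~ (p %| N)%N).

Let rF := abelem_repr abelV ntV nVH.

Local Notation rV := (rVabelem abelV ntV).
Local Notation Vr := (abelem_rV abelV ntV).

Lemma rVabelem_cent (B : {group gT}) v : B \subset H ->
  (rV v \in 'C_V(B)%g) = (v <= rfix_mx rF B)%MS.
Proof.
move=> sBH; rewrite inE mem_rVabelem; apply/centP/rfix_mxP => [cBv b Bb | fix_v b Bb].
  apply: (@rVabelem_inj _ _ _ abelV ntV); rewrite rVabelemJ ?(subsetP sBH) //.
  by rewrite conjgE cBv // mulKg.
apply/commgP/conjg_fixP; have Hb := subsetP sBH b Bb.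
by rewrite -(rVabelemJ abelV ntV nVH) // fix_v.
Qed.

Lemma card_abelem_eig (B : {group gT}) y (k : nat) : B \subset H -> y \in H ->
  #|[set u in 'C_V(B) | (u ^ y == u ^+ k)%g]|
    = (p ^ \rank (rfix_mx rF B :&: eigenspace (rF y) k%:R)%MS)%N.
Proof.
move=> sBH Hy; set A := (_ :&: _)%MS.
have <- : #|rowg A| = (p ^ \rank A)%N by rewrite card_rowg card_Fp.
rewrite -(card_imset _ (@rVabelem_inj _ _ _ abelV ntV)).
have memE v : (rV v \in [set u in 'C_V(B) | (u ^ y == u ^+ k)%g])
    = (v \in rowg A).
  have rVX : rV (k%:R *: v) = (rV v ^+ k)%g.
    rewrite -{1}(rVabelemK abelV ntV v) -abelem_rV_X ?mem_rVabelem //.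
    by rewrite abelem_rV_K // groupX ?mem_rVabelem.
  rewrite inE [RHS]inE sub_capmx -rVabelem_cent // -(rVabelemJ abelV ntV nVH) // -rVX.
  congr (_ && _); apply/eqP/eigenspaceP => [/rVabelem_inj // | ->].
  by [].
apply: eq_card => u; apply/idP/imsetP => [Su | [v]]; last by rewrite -memE => Sv ->.
have Vu : u \in V by move: Su; rewrite !inE => /andP[/andP[]].
by exists (Vr u); rewrite -?memE abelem_rV_K.
Qed.

(** [r y a] is the multiplicity of the eigenvalue [w ^+ a] of [y] on the fixed points of [B], over
    an algebraic closure of the prime field. Only numerical consequences are exported, so the field
    and its roots of unity disappear from the rest of the proof. In the last clause [k] represents
    [w ^+ (N %/ e)], which lies in the prime field. *)
Theorem spectrum (B : {group gT}) : B \subset H -> solvable B ->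
  exists r : gT -> nat -> nat,
  [/\ forall y, y \in 'N_H(B)%g ->
        (\sum_(a < N) r y a)%N = logn p #|'C_V(B)%g|,
      forall y a j, y \in 'N_H(B)%g -> coprime j N ->
        (forall z, z \in H -> (z ^+ j)%g \in z ^: H) -> r y (a * j %% N)%N = r y a,
      forall y a t, y \in 'N_H(B)%g -> r y a != 0%N ->
        (N %| a * t)%N -> 'C_V(<[y ^+ t]> <*> B)%g != 1%g,
      forall y a t, y \in 'N_H(B)%g -> r y a != 0%N ->
        (y ^+ t)%g \in B -> (N %| a * t)%N
    & forall e, (e %| p.-1)%N -> (e %| N)%N -> exists k : nat,
        (forall t, (k ^ t == 1 %[mod p])%N = (e %| t)%N) /\
        (forall y j, y \in 'N_H(B)%g ->
          #|[set u in 'C_V(B) | (u ^ y == u ^+ (k ^ j))%g]| = (p ^ r y (N %/ e * j))%N)].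
Proof.
move=> sBH solB; have [K [f _]] := countable_algebraic_closure 'F_p.
have charK : p \in [pchar K].
  by rewrite (fmorph_pchar f) (pchar_Fp p_pr).
have natr0 (i : nat) : (i%:R == 0 :> K) = (p %| i)%N by rewrite -(dvdn_pcharf charK).
have nzN : N%:R != 0 :> K by rewrite natr0.
have [w prim_w] := closed_prim_root_exists nzN.
have N_gt0 : (0 < N)%N := prim_order_gt0 prim_w.
have [zeta prim_zeta] := C_prim_root_exists N_gt0.
have expN : {in H, forall x, (x ^+ N)%g = 1%g}.
  by move=> x Hx; apply/eqP; rewrite -order_dvdn (dvdn_trans (order_dvdG Hx)).
pose rK := map_repr f rF.
have rank_fix (A : {set gT}) : \rank (rfix_mx rK A) = \rank (rfix_mx rF A).
  by rewrite -map_rfix_mx mxrank_map.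
have card_fix (A : {group gT}) : A \subset H -> #|'C_V(A)%g| = (p ^ \rank (rfix_mx rK A))%N.
  move=> sAH; have := @card_abelem_eig A 1%g 1 sAH (group1 H).
  rewrite (_ : [set u in _ | _] = 'C_V(A)%g); last first.
    by apply/setP => u; rewrite !inE conjg1 expg1 eqxx andbT.
  move=> ->; rewrite rank_fix; congr (p ^ _)%N; apply: eqmx_rank; rewrite capmxSl /=.
  rewrite sub_capmx submx_refl; apply/eigenspaceP.
  by rewrite repr_mx1 mulmx1 scale1r.
pose r y a := \rank (average_mx rK B *m eigproj rK N w y a).
have rE y a : y \in 'N_H(B)%g ->
   r y a = \rank (rfix_mx rK B :&: eigenspace (rK y) (w ^+ a))%MS.
  by case/setIP => Hy nBy; rewrite /r (eigproj_cap rK dvdHN prim_w).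
exists r; split.
- move=> y /setIP[Hy nBy]; rewrite (rank_eig_sum rK dvdHN prim_w) //.
  by rewrite card_fix // pfactorK.
- move=> y a j /setIP[Hy nBy] co_jN ratH.
  rewrite /r eigproj_mod // mulnC.
  exact: (rank_eig_rational rK dvdHN prim_w prim_zeta).
- move=> y a t My; have [Hy nBy] := setIP My; rewrite rE // => nz_r dv_at.
  set A := (<[y ^+ t]> <*> B)%G; have Hyt := groupX t Hy.
  have sAH : A \subset H by rewrite join_subG cycle_subG Hyt.
  have rk_gt0 : (0 < \rank (rfix_mx rK A))%N.
    (* [y ^+ t] and [B] fix this eigenspace over the closure; by [rank_fix] a nonzero fixed space
       there descends to [V]. *)
    apply: (@leq_trans (\rank (rfix_mx rK B :&: eigenspace (rK y) (w ^+ a))%MS)); first by rewrite lt0n.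
    apply: mxrankS; rewrite -rfix_mx_rstabC //= join_subG cycle_subG rfix_mx_rstabC // capmxSl andbT.
    rewrite inE Hyt /=; set X := (_ :&: _)%MS; apply/eqP.
    have Xy : X *m rK y = w ^+ a *: X by apply/eigenspaceP; rewrite capmxSr.
    suff E s : X *m rK (y ^+ s)%g = w ^+ (a * s) *: X.
      by move: dv_at; rewrite E (prim_order_dvd prim_w) => /eqP->; rewrite scale1r.
    elim: s => [|s IHs]; first by rewrite muln0 expg0 repr_mx1 mulmx1 scale1r.
    by rewrite expgSr repr_mxM ?groupX // mulmxA IHs -scalemxAl Xy scalerA mulnS addnC exprD.
  rewrite -cardG_gt1 /= -[X in #|'C_(_)(X)|]/(gval A) card_fix //.
  by rewrite -(expn0 p) ltn_exp2l // prime_gt1.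
- move=> y a t My; have [Hy nBy] := setIP My; rewrite rE // => nz_r Byt.
  have [v sv nz_v] : exists2 v : 'rV_('dim V), (v <= rfix_mx rK B :&: eigenspace (rK y) (w ^+ a))%MS & v != 0.
    by apply/rowV0Pn; rewrite -mxrank_eq0.
  move: sv; rewrite sub_capmx => /andP[/rfix_mxP fix_v /eigenspaceP vy].
  have E s : v *m rK (y ^+ s)%g = w ^+ (a * s) *: v.
    elim: s => [|s IHs]; first by rewrite muln0 expg0 repr_mx1 mulmx1 scale1r.
    by rewrite expgSr repr_mxM ?groupX // mulmxA IHs -scalemxAl vy scalerA mulnS addnC exprD.
  have := E t; rewrite fix_v // -{1}[v]scale1r => /eqP; rewrite -subr_eq0 -scalerBl scaler_eq0.
  by rewrite (negPf nz_v) orbF subr_eq0 eq_sym (prim_order_dvd prim_w).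
- move=> e dv_e1 dv_eN; pose c := w ^+ (N %/ e).
  have prim_c : e.-primitive_root c by apply: dvdn_prim_root.
  have [|k Dk] := unity_root_natr f p_pr (c := c).
    by apply/eqP; rewrite -(prim_order_dvd prim_c).
  exists k; split=> [t|y j My].
    have -> : (e %| t)%N = (c ^+ t == 1) by rewrite -(prim_order_dvd prim_c).
    rewrite Dk -natrX -[1]/(1%:R) -!(rmorph_nat f) (inj_eq (fmorph_inj f)).
    by rewrite -val_eqE /= !val_Fp_nat // Fp_cast.
  have [Hy nBy] := setIP My; rewrite card_abelem_eig // rE //; congr (p ^ _)%N.
  rewrite -(mxrank_map f) map_capmx map_rfix_mx map_eigenspace.
  by rewrite rmorph_nat natrX -Dk -exprM.
Qed.

End Spectrum.

(** A minimal [E]-invariant subgroup of [W] is an irreducible module, faithful by freeness, and an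
    abelian group with a faithful irreducible module is cyclic. *)
Lemma abelian_free_cyclic (gT : finGroupType) (p : nat) (W E : {group gT}) :
    p.-abelem W -> W :!=: 1%g -> E \subset 'N(W) -> abelian E ->
    (forall u, u \in W^# -> 'C_E[u] = 1)%g -> cyclic E.
Proof.
move=> abelW ntW nWE cEE freeE.
have [W1 minW1 sW1W] := minnormal_exists ntW nWE.
have [/andP[ntW1 nW1E] _] := mingroupP minW1.
have abelW1 := abelemS sW1W abelW.
have irr := elimT (abelem_mx_irrP abelW1 ntW1 nW1E) minW1.
apply: mx_faithful_irr_abelian_cyclic irr _ => //.
apply: abelem_mx_faithful; have [u W1u ntu] := trivgPn _ ntW1.
apply/trivgP; rewrite -(freeE u) ?inE ?ntu ?(subsetP sW1W) //.
by rewrite setIS // -cent_cycle centS // cycle_subG.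
Qed.

(** Normal abelian subgroups of a Sylow subgroup [P] are cyclic by freeness. If [P] is not abelian,
    a maximal one has index 2 and [s = 2]: otherwise [P] would have a characteristic elementary
    abelian subgroup of rank 2. The second alternative, as in quaternion groups, costs a single
    factor 2. *)
Lemma free_Sylow_cycle (gT : finGroupType) (p s : nat) (W X : {group gT}) :
    p.-abelem W -> W :!=: 1%g -> X \subset 'N(W) ->
    (forall u, u \in W^# -> 'C_X[u] = 1)%g -> prime s -> (s %| #|X|)%N ->
  exists2 c, exists2 g, g \in X & #[g]%g = (s ^ c)%N
    & c = logn s #|X| \/ [/\ s = 2, logn s #|X| = c.+1 & 1 < c]%N.
Proof.
move=> abelW ntW nWX freeX s_pr s_dv.
have [P sylP] := Sylow_exists s X; have [sPX sP _] := and3P sylP.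
have oP : #|P| = (s ^ logn s #|X|)%N by rewrite (card_Hall sylP) p_part.
have abcyc (Y : {group gT}) : Y <| P -> abelian Y -> cyclic Y.
  move=> nYP cYY; have sYX := subset_trans (normal_sub nYP) sPX.
  apply: (abelian_free_cyclic abelW ntW) => //; first exact: subset_trans nWX.
  by move=> u Wu; apply/trivgP; rewrite -(freeX u Wu) setSI.
have [cPP | not_cPP] := boolP (abelian P).
  have /cyclicP[g Dg] := abcyc P (normal_refl P) cPP.
  exists (logn s #|X|); last by left.
  by exists g; rewrite ?orderE -?Dg // (subsetP sPX) // Dg cycle_id.
have [Y maxY] : {Y | [max Y | Y <| P & abelian Y]}.
  by apply: ex_maxgroup; exists 1%G; rewrite normal1 abelian1.
have cycY : cyclic Y by rewrite abcyc; case/andP: (maxgroupp maxY).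
have scY : Y \in 'SCN(P) := max_SCN sP maxY.
have [[s2 iY _] | [M [_ _ _]]] := cyclic_SCN sP scY not_cPP cycY; last first.
  rewrite 2!inE -andbA => /and3P[sEP abelE dimE_2] charE.
  have := abcyc _ (char_normal charE) (abelem_abelian abelE).
  by rewrite (abelem_cyclic abelE) (eqP dimE_2).
have sYP : Y \subset P by case/andP: (maxgroupp maxY) => /normal_sub.
have /cyclicP[g Dg] := cycY.
have := Lagrange sYP; rewrite iY oP s2 => oY.
(* Groups of order at most 4 are abelian; this gives [1 < c]. *)
have logP_gt2 : (2 < logn 2 #|X|)%N.
  rewrite ltnNge; apply: contra not_cPP => le2.
  move: le2 oP; rewrite s2; case: (logn 2 #|X|) => [|[|[|n]]] // le2 oP.
  - by rewrite (card1_trivg oP) abelian1.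
  - by rewrite cyclic_abelian // prime_cyclic // oP.
  - exact: (card_p2group_abelian (isT : prime 2)).
exists (logn s #|X|).-1; last by right; rewrite s2 prednK ?ltn_predRL // (ltn_trans _ logP_gt2).
exists g; first by rewrite (subsetP sPX) // (subsetP sYP) // Dg cycle_id.
rewrite orderE -Dg s2; apply/eqP; rewrite -(eqn_pmul2r (isT : 0 < 2)%N) oY -expnSr.
by rewrite prednK // (ltn_trans _ logP_gt2).
Qed.

(** * Numerical constraints *)

Local Open Scope nat_scope.
Lemma totient_prime_power_le n s : (0 < n)%N -> prime s -> (s %| n)%N ->
  (s.-1 * s ^ (logn s n).-1 <= totient n)%N.
Proof.
move=> n_gt0 s_pr s_dv; have logn_gt0 : (0 < logn s n)%N by rewrite logn_gt0 mem_primes s_pr n_gt0.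
rewrite -[in leqRHS](partnC s n_gt0) totient_coprime ?coprime_partC // p_part totient_pfactor //.
by rewrite leq_pmulr // totient_gt0 part_gt0.
Qed.

(** Prime powers of totient at most 9 divide 16, 9, 5 or 7, and 5040 is the product of these. *)
Lemma totient_le9_dvd n : (0 < n)%N -> (totient n <= 9)%N -> (n %| 5040)%N.
Proof.
move=> n_gt0 le9; apply/dvdn_partP => // s; rewrite mem_primes => /and3P[s_pr _ s_dv].
have {le9} := leq_trans (totient_prime_power_le n_gt0 s_pr s_dv) le9.
rewrite p_part; have : (0 < logn s n)%N by rewrite logn_gt0 mem_primes s_pr n_gt0.
case: (logn s n) => // b _ /= le9.
have s_le : (s <= 10)%N.
  have s1 : (0 < s.-1)%N by rewrite -subn1 subn_gt0 prime_gt1.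
  have sb_gt0 : (0 < s ^ b)%N by rewrite expn_gt0 prime_gt0.
  have := leq_trans (leq_pmulr s.-1 sb_gt0) le9; lia.
have big_b k : (k <= b)%N -> (s ^ k <= s ^ b)%N by move=> le_kb; rewrite leq_pexp2l ?prime_gt0.
move: s s_pr le9 s_le big_b {s_dv}; do 11?[case=> //] => _ le9 _ big_b.
- by case: b le9 big_b => [|[|[|[|b]]]] // le9 /(_ 4 isT); lia.
- by case: b le9 big_b => [|[|b]] // le9 /(_ 2 isT); lia.
- by case: b le9 big_b => [|b] // le9 /(_ 1%N isT); lia.
- by case: b le9 big_b => [|b] // le9 /(_ 1%N isT); lia.
Qed.

(** Products of two numbers at most 3 are below 8 or equal to 9, hence are excluded here. Only
    divisors of 5040 remain to be inspected. *)
Lemma totient_big n : (18 < n)%N -> (8 <= totient n)%N && (totient n != 9).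
Proof.
move=> n_gt; have n_gt0 : (0 < n)%N by apply: leq_trans n_gt.
have [le9 | lt9] := leqP (totient n) 9; last by rewrite (leq_trans _ lt9) // gtn_eqF.
have : n \in divisors 5040 by rewrite -dvdn_divisors // totient_le9_dvd.
have : all (fun d => (18 < d) ==> (8 <= totient d) && (totient d != 9))%N (divisors 5040) by vm_compute.
by move=> /allP chk /chk; rewrite n_gt.
Qed.

(** The constant is 420 * 4: it arises mainly from bounds 3 * 420 * m with 3 * m at most 4 * n. *)
Lemma expn_gt1680 n : (4 <= n)%N -> (1680 * n < 11 ^ n)%N.
Proof.
move/subnK <-; elim: (n - 4)%N => // k IHk; rewrite addSn expnS; lia.
Qed.

Lemma geom_lower p o D : (0 < o)%N -> ((p ^ D).-1 * p ^ (o.-1 * D) <= (p ^ (o * D)).-1)%N.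
Proof.
case: o => // o _ /=; rewrite mulSn expnD -!subn1 mulnBl mul1n.
have [->|p_gt0] := posnP p.
  case: D => [|D]; first by rewrite expn0 mul1n muln0 expn0 subnn.
  by rewrite exp0n // !mul0n sub0n.
by rewrite leq_sub2l // expn_gt0 p_gt0.
Qed.

Lemma dvdn_check n x (P : pred nat) : (0 < n)%N -> (x %| n)%N -> all P (divisors n) -> P x.
Proof. by move=> n_gt0 dv_xn /allP; apply; rewrite -dvdn_divisors. Qed.
Section Numeric.
Variables (p m x iota : nat) (Ne : nat -> nat).
Hypotheses (p_pr : prime p) (p_ge11 : (11 <= p)%N) (m_gt0 : (0 < m)%N).
Hypotheses (x_gt0 : (0 < x)%N) (dv_x : (x %| (p ^ m).-1)%N) (dv_x420 : (x %| 420 * (iota * m))%N).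
Hypothesis iota_bnd : (0 < iota <= 3)%N.
Hypothesis dv57 : forall s, s \in [:: 5; 7]%N -> (s %| x)%N -> (s.-1 %| iota * m)%N.
Hypothesis full : forall e, (e %| p.-1)%N ->
  exists o i : nat, [/\ (o * i)%N = totient e, (i %| iota)%N, (o %| m)%N
    & ((p ^ m).-1 * i <= Ne e * (p ^ (m %/ o)).-1)%N].
Hypothesis sumN : forall e e', e != e' -> (Ne e + Ne e' <= x)%N.

(* Bounds [x], a divisor of [n] and of [p ^ m - 1] prime to [s], by inspecting the divisors of [n]. *)
Let check s h n b : ~~ (s %| x)%N -> m = (2 * h)%N -> (0 < n)%N -> (x %| n)%N ->
  all (fun d => if (d < b)%N then true else
         (s %| d)%N || ~~ ((p ^ 2 %% d) ^ h %% d == 1 %% d))%N (divisors n) ->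
  (x < b)%N.
Proof.
move=> /negPf s'x Dh n_gt0 dv_xn /(dvdn_check n_gt0 dv_xn); rewrite s'x; case: ifP => // _ /negP[].
have pm_gt0 : (0 < p ^ m)%N by rewrite expn_gt0; lia.
by rewrite modnXm -expnM -Dh eqn_mod_dvd // subn1.
Qed.

Let x0 : ~~ (0 %| x)%N. Proof. by rewrite dvd0n; lia. Qed.

(** To be read with [m] the dimension of [U], [x] the order of [X], [iota] the index of [L], and
    [Ne e] the number of elements of order [e] in [X]. At [e = p.-1], [full] gives
    [i * p ^ (o.-1 * D) <= x] with [m = D * o], while [x] is at most linear in [m]; this leaves few
    cases. The surviving numbers are those of SL(2,5) acting on the plane over F_11, so that
    arithmetic alone cannot exclude them. *)
Lemma full_numeric : [/\ p = 11, m = 2, (24 <= Ne 5)%N & (24 <= Ne 10)%N].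
Proof.
have p1_gt0 : (0 < p.-1)%N by move: p_ge11; clear; lia.
have p_gt1 : (1 < p)%N by apply: prime_gt1.
have [o [i [Doi dv_i dv_om le_N]]] := full (dvdnn p.-1).
have tot_gt0 : (0 < totient p.-1)%N by rewrite totient_gt0.
have o_gt0 : (0 < o)%N by apply: dvdn_gt0 dv_om.
have i_gt0 : (0 < i)%N by move: tot_gt0; rewrite -Doi muln_gt0 => /andP[].
have [D Dm] := dvdnP dv_om.
have D_gt0 : (0 < D)%N by move: m_gt0; rewrite Dm muln_gt0 => /andP[].
have DmDo : (m %/ o = D)%N by rewrite Dm mulnK.
have pD_gt0 : (0 < (p ^ D).-1)%N by rewrite -subn1 subn_gt0 -(expn0 p) ltn_exp2l.
(* [p] serves as an index different from [p.-1]. *)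
have Nx : (Ne p.-1 <= x)%N.
  by apply: leq_trans (leq_addr _ _) (@sumN p.-1 p _); rewrite ltn_eqF ?ltn_predL // ltnW.
have key : (i * p ^ (o.-1 * D) <= x)%N.
  rewrite -(leq_pmul2r pD_gt0); apply: (@leq_trans ((p ^ m).-1 * i)).
    by rewrite -mulnA [leqRHS]mulnC leq_mul2l mulnC Dm (mulnC D) geom_lower ?orbT.
  by apply: leq_trans le_N _; rewrite DmDo leq_mul2r Nx orbT.
have x_le : (x <= 420 * (iota * m))%N by rewrite dvdn_leq // !muln_gt0 m_gt0; case/andP: iota_bnd => ->.
(* 2520 is 420 * 6, and [iota], being at most 3, divides 6; one list of divisors thus serves for
   every [iota]. *)
have dv_x6 : (x %| 2520 * m)%N.
  apply: dvdn_trans dv_x420 _; rewrite mulnA dvdn_pmul2r //.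
  by rewrite (@dvdn_pmul2l 420 _ 6) //; move: iota_bnd; case: (iota) => [|[|[|[|]]]].
have le_i : (i <= iota)%N by rewrite dvdn_leq //; case/andP: iota_bnd.
have i_le3 : (i <= 3)%N by move: le_i iota_bnd; clear; lia.
have even_iota : (2 %| iota)%N -> iota = 2.
  by move: iota_bnd; case: (iota) => [|[|[|[|]]]].
have three_iota : (3 %| iota)%N -> iota = 3.
  by move: iota_bnd; case: (iota) => [|[|[|[|]]]].
have p_exp n : (11 ^ n <= p ^ n)%N by case: n => // n; rewrite leq_exp2r.
have D_small : o = 2 -> i = 2 -> iota = 2 -> (D <= 3)%N.
  move=> o2 i2 iota2; rewrite leqNgt; apply/negP => D_gt3; have := expn_gt1680 D_gt3.
  by move: (p_exp D) key x_le; rewrite o2 i2 iota2 Dm o2 mul1n; clear; lia.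
(* For [o >= 4] the exponent [n] is at least 3/4 of [m], and [expn_gt1680] leaves only [n = 3]. *)
have [ge4 | lt4] := leqP 4 o.
  set n := (o.-1 * D)%N in key.
  have n_ge3 : (3 <= n)%N by rewrite /n; move: ge4 D_gt0; clear; nia.
  have m_le : (3 * m <= 4 * n)%N by rewrite /n Dm; move: ge4 D_gt0; clear; nia.
  have pn : (p ^ n <= 1680 * n)%N.
    have: (p ^ n <= i * p ^ n)%N by rewrite leq_pmull.
    have: (iota * m <= 3 * m)%N by rewrite leq_mul2r; case/andP: iota_bnd => _ ->; rewrite orbT.
    by move: key x_le m_le; clear; lia.
  have n3 : n = 3.
    apply/eqP; rewrite eqn_leq n_ge3 andbT leqNgt; apply/negP => n_ge4.
    have := expn_gt1680 n_ge4; rewrite ltnNge => /negP[]; apply: leq_trans pn.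
    exact: p_exp.
  have [o4 D1] : o = 4 /\ D = 1%N by move: n3 ge4 D_gt0; rewrite /n; clear; nia.
  have m4 : m = 4 by rewrite Dm o4 D1.
  have {n_ge3 m_le} Dm4 : m = (2 * 2)%N by rewrite m4.
  rewrite n3 in pn key; rewrite m4 in x_le dv_x6.
  have tot4 : totient p.-1 = (4 * i)%N by rewrite -Doi o4.
  have p_le : (p <= 17)%N.
    rewrite leqNgt; apply/negP => p_gt; have : (18 ^ 3 <= p ^ 3)%N by rewrite leq_exp2r.
    by move: pn; clear; lia.
  have : p \in [:: 11; 12; 13; 14; 15; 16; 17]%N.
    by rewrite !inE; move: p_ge11 p_le; clear; lia.
  rewrite !inE => /or4P[/eqP Dp | /eqP Dp | /eqP Dp |]; try by move: p_pr; rewrite Dp.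
  - have i1 : i = 1%N by move: tot4; rewrite Dp (_ : totient 11.-1 = 4) //; clear; lia.
    have : (x < 11 ^ 3)%N by apply: (@check 0 2 _ _ x0 Dm4 _ dv_x6); rewrite ?Dp; vm_compute.
    by move: key; rewrite i1 Dp mul1n leqNgt => /negP.
  - have i1 : i = 1%N by move: tot4; rewrite Dp (_ : totient 13.-1 = 4) //; clear; lia.
    have : (x < 13 ^ 3)%N by apply: (@check 0 2 _ _ x0 Dm4 _ dv_x6); rewrite ?Dp; vm_compute.
    by move: key; rewrite i1 Dp mul1n leqNgt => /negP.
  case/or4P=> [/eqP Dp | /eqP Dp | /eqP Dp | /eqP Dp]; try by move: p_pr; rewrite Dp.
  have i2 : i = 2 by move: tot4; rewrite Dp (_ : totient 17.-1 = 8) //; clear; lia.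
  have iota2 : iota = 2 by apply: even_iota; move: dv_i; rewrite i2.
  by move: key x_le; rewrite i2 iota2 Dp; clear; lia.
(* Now [o] and [i] are at most 3, so [totient_big] rules out larger [p.-1]. *)
have p_le : (p <= 19)%N.
  rewrite leqNgt; apply/negP => p_gt; have /andP[] : (8 <= totient p.-1)%N && (totient p.-1 != 9).
    by apply: totient_big; move: p_gt; clear; lia.
  by rewrite -Doi; move: lt4 i_le3; clear; nia.
have o2i2 : (o * i = 4)%N -> o = 2 /\ i = 2 by move: lt4 i_le3; clear; nia.
have : p \in [:: 11; 12; 13; 14; 15; 16; 17; 18; 19]%N.
  by rewrite !inE; move: p_ge11 p_le; clear; lia.
rewrite !inE => /or4P[/eqP Dp | /eqP Dp | /eqP Dp |]; try by move: p_pr; rewrite Dp.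
- have [o2 i2] : o = 2 /\ i = 2 by apply: o2i2; rewrite Doi Dp.
  have iota2 : iota = 2 by apply: even_iota; move: dv_i; rewrite i2.
  have D_le3 := D_small o2 i2 iota2; rewrite o2 i2 Dp in key.
  have [D1|D_neq1] := eqVneq D 1%N.
    (* The surviving case: [full] at 5 bounds [Ne 5], and [full] at [p.-1] bounds [Ne 10]. *)
    have m2 : m = 2 by rewrite Dm D1 o2.
    have /full[o' [i' []]] : (5 %| p.-1)%N by rewrite Dp.
    rewrite (_ : totient 5 = 4) // m2 iota2 => oi' /dvdn_leq le_i' /dvdn_leq le_o' le_N'.
    have [o2' i2'] : o' = 2 /\ i' = 2.
      by have := le_i' isT; have := le_o' isT; move: oi'; clear; nia.
    split=> //; first by move: le_N'; rewrite o2' i2' Dp (_ : 2 %/ 2 = 1)%N //; clear; lia.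
    by move: le_N; rewrite DmDo D1 i2 m2 Dp (_ : 11.-1 = 10)%N //; clear; lia.
  have /orP[/eqP D2 | /eqP D3] : (D == 2) || (D == 3) by move: D_gt0 D_le3 D_neq1; clear; lia.
    rewrite D2 o2 in Dm key; rewrite Dm in dv_x6.
    have : (x < 2 * 11 ^ 2)%N by apply: (@check 0 2 _ _ x0 Dm _ dv_x6); rewrite ?Dp; vm_compute.
    by rewrite ltnNge => /negP[].
  rewrite D3 o2 in Dm key; rewrite Dm in dv_x6.
  have : (x < 2 * 11 ^ 3)%N by apply: (@check 0 3 _ _ x0 Dm _ dv_x6); rewrite ?Dp; vm_compute.
  by rewrite ltnNge => /negP[].
- have [o2 i2] : o = 2 /\ i = 2 by apply: o2i2; rewrite Doi Dp.
  have iota2 : iota = 2 by apply: even_iota; move: dv_i; rewrite i2.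
  have D_le3 := D_small o2 i2 iota2.
  have no7 : (D < 3)%N -> ~~ (7 %| x)%N.
    move=> D_lt3; apply/negP => /(dv57 (isT : 7 \in [:: 5; 7]%N)).
    by rewrite iota2 Dm o2; case: (D) D_gt0 D_lt3 => [|[|[|]]].
  have D123 : [\/ D = 1%N, D = 2 | D = 3] by case: (D) D_gt0 D_le3 => [|[|[|[|]]]] //; constructor.
  case: D123 => DE; rewrite DE o2 mulnC in Dm no7 key; rewrite i2 Dp in key; rewrite Dm in dv_x6.
  - have : (x < 2 * 13 ^ 1)%N by apply: (@check 7 1 _ _ (no7 isT) Dm _ dv_x6); rewrite ?Dp; vm_compute.
    by rewrite ltnNge => /negP[].
  - have : (x < 2 * 13 ^ 2)%N by apply: (@check 7 2 _ _ (no7 isT) Dm _ dv_x6); rewrite ?Dp; vm_compute.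
    by rewrite ltnNge => /negP[].
  have : (x < 2 * 13 ^ 3)%N by apply: (@check 0 3 _ _ x0 Dm _ dv_x6); rewrite ?Dp; vm_compute.
  by rewrite ltnNge => /negP[].
case/or4P=> [/eqP Dp | /eqP Dp | /eqP Dp |]; try by move: p_pr; rewrite Dp.
case/or3P=> /eqP Dp; [|by move: p_pr; rewrite Dp|].
  have oi : (o * i = 8)%N by rewrite Doi Dp.
  by exfalso; move: lt4 i_le3 oi; clear; nia.
have [[o3 i2] | [o2 i3]] : (o = 3 /\ i = 2) \/ (o = 2 /\ i = 3).
- have oi : (o * i = 6)%N by rewrite Doi Dp.
  by move: lt4 i_le3 oi; clear; nia.
- have iota2 : iota = 2 by apply: even_iota; move: dv_i; rewrite i2.
  have D1 : D = 1%N.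
    apply/eqP; rewrite eqn_leq D_gt0 andbT leqNgt; apply/negP => D_ge2.
    have := @expn_gt1680 (2 * D); have := p_exp (2 * D)%N.
    by move: D_ge2 key x_le; rewrite o3 i2 iota2 Dm o3 (_ : 3.-1 = 2)%N //; clear; lia.
  rewrite D1 o3 i2 Dp in Dm key.
  have : (x %| gcdn (19 ^ 3).-1 (420 * (2 * 3)))%N.
    by rewrite dvdn_gcd; move: dv_x dv_x420; rewrite iota2 Dm Dp => -> ->.
  rewrite (_ : gcdn _ _ = 18); last by vm_compute.
  by move/dvdn_leq => /(_ isT); move: key; rewrite muln1 (_ : 3.-1 = 2)%N //; clear; lia.
have iota3 : iota = 3 by apply: three_iota; move: dv_i; rewrite i3.
have D_le2 : (D <= 2)%N.
  rewrite leqNgt; apply/negP => D_gt2.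
  move: key x_le; rewrite o2 i3 iota3 Dm o2 mul1n.
  have [-> | D_neq3] := eqVneq D 3; first by rewrite Dp; clear; lia.
  by move: (p_exp D) (@expn_gt1680 D) D_neq3 D_gt2; clear; lia.
have D12 : D = 1%N \/ D = 2 by move: D_le2 D_gt0; clear; lia.
case: D12 => DE; rewrite DE o2 mulnC in Dm key; rewrite i3 Dp in key; rewrite Dm in dv_x6.
  have no5 : ~~ (5 %| x)%N.
    apply/negP => /(dv57 (isT : 5 \in [:: 5; 7]%N)).
    by rewrite iota3 Dm.
  have : (x < 120)%N by apply: (@check 5 1 _ _ no5 Dm _ dv_x6); rewrite ?Dp; vm_compute.
  (* [full] at 9 and at 18 yields at least 60 elements of each order, against [x < 120]. *)
  have /full[o' [i' []]] : (9 %| p.-1)%N by rewrite Dp.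
  rewrite (_ : totient 9 = 6) // Dm iota3 => oi' /dvdn_leq le_i' /dvdn_leq le_o' le_N'.
  have [o2' i3'] : o' = 2 /\ i' = 3.
    by have := le_i' isT; have := le_o' isT; move: oi'; clear; nia.
  move: le_N le_N' (@sumN 9 18 isT); rewrite o2' i3' i3 Dm o2 Dp muln1 (_ : 19.-1 = 18) //; clear; lia.
have : (x < 3 * 19 ^ 2)%N by apply: (@check 0 2 _ _ x0 Dm _ dv_x6); rewrite ?Dp; vm_compute.
by rewrite ltnNge => /negP[].
Qed.

End Numeric.
(** The factor is 3 plus [(p ^ D).-1]: [x * (p ^ D).-1] will bound the rational vectors, and [3 * x]
    the others. Size alone suffices for [m >= 5]; for smaller [m] the divisibility conditions reduce
    [x] to at most 2, 24, 2 and 240. *)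
Lemma free_numeric p m x D :
    (11 <= p)%N -> (0 < m)%N -> (x %| 420 * m)%N ->
    (forall s, s \in [:: 3; 5; 7]%N -> (s %| x)%N -> (s.-1 %| m)%N) ->
    ((4 %| x)%N -> (2 %| m)%N) -> (4 * D <= m)%N ->
  (x * (2 + p ^ D) < (p ^ m).-1)%N.
Proof.
move=> p_ge m_gt0 dv_x dv357 dv4 D_le; rewrite ltnNge; apply/negP => le_pm.
have p_gt1 : 1 < p by apply: leq_trans p_ge.
have p_gt0 := ltnW p_gt1.
have x_le : (x <= 420 * m)%N by rewrite dvdn_leq // muln_gt0.
have [m_ge5 | m_lt5] := leqP 5 m.
  have [n [Dm n_ge4]] : exists n, m = n + D /\ 4 <= n.
    by exists (m - D); move: m_ge5 D_le; clear; lia.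
  have := expn_gt1680 n_ge4; have : 11 ^ n <= p ^ n by rewrite leq_exp2r // (leq_trans _ n_ge4).
  have x_le' : x <= 560 * n by move: x_le D_le; rewrite Dm; clear; lia.
  have pD_gt0 : 0 < p ^ D by rewrite expn_gt0 p_gt0.
  have [D0 | D_gt0] := posnP D.
    move: le_pm x_le n_ge4; rewrite Dm D0 expn0 addn0 -subn1; clear.
    by move: (p ^ n) (11 ^ n) => a b; lia.
  have pD_gt1 : 1 < p ^ D by rewrite -(expn0 p) ltn_exp2l.
  have : x * (2 + p ^ D) <= 560 * n * (3 * p ^ D).
    by rewrite leq_mul //; move: pD_gt1; clear; lia.
  move: le_pm pD_gt1; rewrite Dm expnD -subn1; move: (p ^ n) (p ^ D) (11 ^ n) => a b c; clear.
  move=> le1 b_gt1 le2 le_ca lt_c.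
  have : (1680 * n).+1 * b <= a * b by rewrite leq_mul2r (leq_trans lt_c) ?orbT.
  by move: le1 b_gt1 le2; clear; move: (a * b) (x * _) => y z; nia.
have check n b : (0 < n)%N -> (x %| n)%N ->
    all (fun d => [|| (d <= b), (3 %| d) && ~~ (2 %| m), (5 %| d) && ~~ (4 %| m),
                      (7 %| d) && ~~ (6 %| m) | (4 %| d) && ~~ (2 %| m)])%N (divisors n) -> (x <= b)%N.
  move=> n_gt0 dv_xn /(dvdn_check n_gt0 dv_xn) /orP[//|].
  move: (introT implyP (dv357 3 isT)) (introT implyP (dv357 5 isT)) (introT implyP (dv357 7 isT)).
  move: (introT implyP dv4) => /=; case: (3 %| x); case: (5 %| x); case: (7 %| x); case: (4 %| x);
  by case: (2 %| m); case: (4 %| m); case: (6 %| m).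
have [m1 | [m2 | [m3 | m4]]] : m = 1%N \/ m = 2 \/ m = 3 \/ m = 4 by move: m_gt0 m_lt5; clear; lia.
- have D0 : D = 0 by apply/eqP; rewrite -leqn0 -ltnS -(ltn_pmul2l (isT : 0 < 4)) (leq_ltn_trans D_le) // m1.
  have : (x <= 2)%N by apply: (check _ _ _ dv_x); rewrite m1; vm_compute.
  by move: le_pm p_ge; rewrite m1 D0 -subn1; clear; lia.
- have D0 : D = 0 by apply/eqP; rewrite -leqn0 -ltnS -(ltn_pmul2l (isT : 0 < 4)) (leq_ltn_trans D_le) // m2.
  have : (x <= 24)%N by apply: (check _ _ _ dv_x); rewrite m2; vm_compute.
  by move: le_pm p_ge; rewrite m2 D0 -subn1; clear; nia.
- have D0 : D = 0 by apply/eqP; rewrite -leqn0 -ltnS -(ltn_pmul2l (isT : 0 < 4)) (leq_ltn_trans D_le) // m3.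
  have : (x <= 2)%N by apply: (check _ _ _ dv_x); rewrite m3; vm_compute.
  by move: le_pm p_ge; rewrite m3 D0 -subn1; clear; nia.
have : (x <= 240)%N by apply: (check _ _ _ dv_x); rewrite m4; vm_compute.
have : p ^ D <= p.
  by rewrite -[leqRHS]expn1 leq_exp2l //; move: D_le; rewrite m4; clear; lia.
have : 11 ^ 3 * p <= p ^ 4 by rewrite (expnSr p 3) leq_mul2r leq_exp2r // p_ge orbT.
move: le_pm p_ge; rewrite m4 -subn1; clear; move: (p ^ D) (p ^ 4) => b c; nia.
Qed.

(** Solvability provides a Hall subgroup of order 15, which normalizes its Sylow 5-subgroup. The
    number of Sylow 5-subgroups then divides 8 and is 1 modulo 5, so it is 1. *)
Lemma solvable_card_order5 (gT : finGroupType) (X : {group gT}) :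
    solvable X -> #|X| %| 120 -> 15 %| #|X| ->
  #|[set g in X | #[g]%g == 5]| <= 5.
Proof.
move=> solX dvX120 dv15X; pose pi : nat_pred := [pred s | (s == 3) || (s == 5)].
have [K hallK] := Hall_exists pi solX; have [sKX piK _] := and3P hallK.
have oK : #|K| = 15.
  apply/eqP; rewrite eqn_dvd; apply/andP; split; last first.
    have p15 : pi.-nat 15 by [].
    by rewrite (card_Hall hallK) -(part_pnat_id p15) partn_dvd.
  have: #|K| %| 8 * 15 := dvdn_trans (cardSg sKX) dvX120.
  by rewrite Gauss_dvdr // (pnat_coprime piK).
have oSyl5 (Y : {group gT}) : Y \subset X -> 5 %| #|Y| -> #|Y|`_5 = 5.
  move=> sYX dv5Y; rewrite p_part; have -> // : logn 5 #|Y| = 1.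
  apply/eqP; rewrite eqn_leq; apply/andP; split; last first.
    by rewrite logn_gt0 mem_primes dv5Y cardG_gt0.
  exact: (dvdn_leq_log 5 (isT : 0 < 120) (dvdn_trans (cardSg sYX) dvX120)).
have [P sylP_K] := Sylow_exists 5 K; have [sPK p5P _] := and3P sylP_K.
have oP : #|P| = 5 by rewrite (card_Hall sylP_K) oSyl5 // oK.
have sylP : 5.-Sylow(X) P.
  by rewrite pHallE (subset_trans sPK) //= oP oSyl5 // (dvdn_trans _ dv15X).
have one_Syl (Y : {group gT}) n : 0 < n -> #|'Syl_5(Y)| %| n ->
    all (fun d => (d %% 5 == 1) ==> (d == 1)) (divisors n) -> #|'Syl_5(Y)| = 1.
  by move=> n_gt0 dvn /(dvdn_check n_gt0 dvn); rewrite card_Syl_mod //= => /eqP.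
have sKN : K \subset 'N_X(P).
  have /eqP : #|K : 'N_K(P)| = 1.
    by rewrite -(card_Syl sylP_K) (@one_Syl K 15) // -oK card_Syl_dvd.
  by rewrite indexg_eq1 => /subset_trans sKN; rewrite subsetI sKX sKN ?subsetIr.
have sXN : X \subset 'N_X(P).
  rewrite -indexg_eq1 -(card_Syl sylP) (@one_Syl X 8) // (card_Syl sylP).
  apply: (@dvdn_trans #|X : K|); first by apply: indexgS.
  by rewrite -(@dvdn_pmul2l 15) // -oK Lagrange // oK.
have nPX : P <| X by rewrite /normal (subset_trans sPK) // (subset_trans sXN) ?subsetIr.
rewrite -oP; apply/subset_leq_card/subsetP => g; rewrite inE => /andP[Xg /eqP og].
by rewrite (mem_normal_Hall sylP) // /p_elt og.
Qed.
Local Open Scope ring_scope.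

(** * Free actions on elementary abelian groups *)

Lemma prim_root_mod p : prime p -> exists k : nat, forall t, (k ^ t == 1 %[mod p])%N = (p.-1 %| t)%N.
Proof.
move=> p_pr; have p_gt1 := prime_gt1 p_pr; have p_gt0 := prime_gt0 p_pr.
pose rs := enum (predC1 (0 : 'F_p)).
have : has (p.-1).-primitive_root rs.
  apply: has_prim_root; rewrite ?enum_uniq //.
  - by rewrite -subn1 subn_gt0.
  - apply/allP => x; rewrite mem_enum unity_rootE => nz_x.
    have xp : x ^+ p = x by rewrite -[RHS]expf_card card_Fp.
    by apply/eqP/(mulfI nz_x); rewrite -exprS prednK // xp mulr1.
  by rewrite -cardE cardC1 card_Fp.
case/hasP => x _ prim_x; exists (val x) => t.
rewrite (prim_order_dvd prim_x) -[in RHS](natr_Zp x) /=; move: (nat_of_ord x) => k.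
by rewrite -natrX -[1]/(1%:R) -val_eqE /= !val_Fp_nat // Fp_cast.
Qed.

(** By convexity the ratio of [(p ^ d).-1] to [d] does not decrease. This bounds sums of such terms
    when the exponents have a bounded total and each is at most [D]. *)
Lemma expn_convex p d D : (0 < p)%N -> (d <= D)%N -> ((p ^ d).-1 * D <= d * (p ^ D).-1)%N.
Proof.
move=> p_gt0 /subnK <-; elim: (D - d)%N => [|n IHn]; first by rewrite !add0n mulnC.
rewrite addSn mulnS addnC; apply: leq_trans (leq_add IHn (leqnn _)) _.
have [-> | d_gt0] := posnP d; first by rewrite expn0.
case: p p_gt0 IHn => [|[|p]] // _ _; first by rewrite !exp1n muln0.
have ->: ((p.+2 ^ (n + d).+1).-1 = (p.+2 ^ (n + d)).-1 + p.+1 * p.+2 ^ (n + d))%N.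
  by rewrite expnS mulSn -!subn1 addnBAC // expn_gt0.
rewrite mulnDr leq_add2l; apply: leq_trans (leq_pred _) _.
rewrite -[leqLHS]mul1n leq_mul // -[leqLHS]mul1n leq_mul // leq_exp2l //.
by rewrite leq_addl.
Qed.

Lemma card_coset_pred (gT : finGroupType) (M B : {group gT}) (P : pred (coset_of B)) :
    B <| M ->
  #|[set y in M | P (coset B y)]| = (#|[set g in (M / B)%g | P g]| * #|B|)%N.
Proof.
case/andP => sBM nBM; rewrite -sum1_card (partition_big (coset B) (mem [set g in (M / B)%g | P g])) /=.
  rewrite -sum_nat_const; apply: eq_bigr => g; rewrite inE => /andP[/morphimP[y nBy My ->] Py].
  rewrite sum1dep_card -(card_rcoset B y) -val_coset //; apply: eq_card => z.
  rewrite !inE; apply/idP/idP => [/andP[/andP[Mz _] /eqP <-] | ].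
    by rewrite val_coset ?rcoset_refl ?(subsetP nBM).
  rewrite val_coset // => /rcosetP[b Bb ->]; have Mb := subsetP sBM b Bb; rewrite groupM //=.
  have -> : coset B (b * y)%g = coset B y by rewrite mkerl ?ker_coset.
  by rewrite Py eqxx.
by move=> y; rewrite !inE => /andP[My ->]; rewrite mem_quotient.
Qed.

(** * The free action of [X] on [U] *)

Section FreeQuotient.
Variables (gT : finGroupType) (p : nat) (V H B : {group gT}).
Hypotheses (p_pr : prime p) (abelV : p.-abelem V) (nVH : H \subset 'N(V)).
Hypotheses (p'H : ~~ (p %| #|H|)%N) (solH : solvable H) (sBH : B \subset H).
Local Notation U := 'C_V(B)%G.
Local Notation M := 'N_H(B)%G.
Local Notation X := ('N_H(B) / B)%G.
Hypothesis ntU : U :!=: 1%g.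
Hypothesis freeB : forall u, u \in U -> u != 1%g -> 'C_H[u]%g = B.

Let m := logn p #|U|.

Let pU : p.-group U.
Proof. by apply: pgroupS (abelem_pgroup abelV); rewrite subsetIl. Qed.

Lemma cardU : #|U| = (p ^ m)%N.
Proof. by rewrite -p_part part_pnat_id. Qed.

Lemma m_gt0 : (0 < m)%N.
Proof.
by rewrite lt0n; apply: contra ntU => /eqP m0; rewrite trivg_card1 cardU m0.
Qed.

Lemma sMU : M \subset 'N(U).
Proof.
rewrite normsI //; first exact: subset_trans (subsetIl _ _) nVH.
by rewrite norms_cent // subsetIr.
Qed.

Lemma tiUB : U :&: B = 1%g.
Proof.
apply: coprime_TIg; rewrite cardU coprimeXl // prime_coprime //.
by apply: contra p'H => /dvdn_trans; apply; apply: cardSg.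
Qed.

Lemma coset_exp y t : y \in M -> ((y ^+ t)%g \in B) = (#[coset B y]%g %| t)%N.
Proof.
case/setIP => Hy nBy; rewrite order_dvdn -morphX //.
by apply/idP/eqP => [/coset_id // | /coset_idr -> //]; rewrite groupX.
Qed.

Lemma stab_free u y : u \in U -> u != 1%g -> y \in H -> (u ^ y == u)%g -> y \in B.
Proof.
move=> Uu ntu Hy uy; rewrite -(freeB Uu ntu) inE Hy; apply/cent1P.
by apply/esym/commgP/conjg_fixP/eqP.
Qed.

Lemma card_quo_dvd : (#|X| %| (p ^ m).-1)%N.
Proof.
have actsM : [acts M, on U^# | 'J] by rewrite astabsJ normD1 sMU.
have [||dvX _] := @orbit_sum_dvd _ _ _ 'J%act M U^# #|X| (fun=> 1%N) actsM.
- move=> u /setD1P[ntu Uu]; rewrite card_orbit.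
  have -> : 'C_M[u | 'J]%g = B.
    apply/setP => y; rewrite astab1J -setIA; apply/idP/idP.
      by rewrite -(freeB Uu ntu) !inE => /and3P[-> _ ->].
    move=> By; rewrite inE inE (subsetP sBH) // (subsetP (normG B)) //=.
    by rewrite -(freeB Uu ntu) in By; case/setIP: By.
  by rewrite card_quotient ?subsetIr // normal_norm.
- by [].
by move: dvX; rewrite sum1_card -cardU (cardsD1 1%g U) group1.
Qed.

Lemma pexp1 u k : u \in U -> u != 1%g -> coprime k p -> (u ^+ k)%g \in U /\ (u ^+ k)%g != 1%g.
Proof.
move=> Uu ntu co_kp; split; first exact: groupX.
have [Vu _] := setIP Uu.
by rewrite -order_dvdn (abelem_order_p abelV) // -prime_coprime // coprime_sym.
Qed.

(** [u] and [u ^+ k] have the same stabilizer [B], and [h] conjugates the first stabilizer to the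
    second. *)
Lemma mult_norm u h k : u \in U -> u != 1%g -> h \in H -> coprime k p ->
  (u ^ h)%g = (u ^+ k)%g -> h \in M.
Proof.
move=> Uu ntu Hh co_kp Duh; have [Uk ntk] := pexp1 Uu ntu co_kp.
rewrite inE Hh; apply/normP.
by rewrite -{1}(freeB Uu ntu) conjIg conjGid // -cent1J Duh freeB.
Qed.

Lemma mult_exp u y k t : u \in U -> (u ^ y)%g = (u ^+ k)%g -> (u ^ (y ^+ t))%g = (u ^+ (k ^ t))%g.
Proof.
move=> Uu Duy; elim: t => [|t IHt]; first by rewrite expg0 conjg1 expg1.
by rewrite expgSr conjgM IHt conjXg Duy -expgM expnS.
Qed.

Lemma expg_eq1 u a : u \in U -> u != 1%g -> ((u ^+ a)%g == u) = (a == 1 %[mod p])%N.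
Proof.
move=> Uu ntu; have [Vu _] := setIP Uu.
by rewrite -{2}[u]expg1 eq_expg_mod_order (abelem_order_p abelV).
Qed.

(** By freeness a power of [y] lies in [B] exactly when it fixes [u], that is, when the same power
    of [k] is 1 modulo [p]. *)
Lemma mult_order u y k e : u \in U -> u != 1%g -> y \in M -> (u ^ y)%g = (u ^+ k)%g ->
  (forall t, (k ^ t == 1 %[mod p])%N = (e %| t)%N) -> #[coset B y]%g = e.
Proof.
move=> Uu ntu My Duy ke; have [Hy _] := setIP My.
suff E t : (#[coset B y]%g %| t)%N = (e %| t)%N by apply/eqP; rewrite eqn_dvd E dvdnn -E dvdnn.
rewrite -ke -(expg_eq1 _ Uu ntu) -coset_exp // -(mult_exp t Uu Duy).
apply/idP/idP => [Byt | /(stab_free Uu ntu) -> //]; last exact: groupX.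
have := Byt; rewrite -(freeB Uu ntu) inE => /andP[_ /cent1P cu].
by rewrite conjgE -cu mulKg.
Qed.

Lemma coset_onto g : g \in X -> exists2 y, y \in M & g = coset B y.
Proof. by case/morphimP => y _ My ->; exists y. Qed.

Lemma quo_Sylow_cycle s : prime s -> (s %| #|X|)%N ->
  exists2 c, exists2 g, g \in X & #[g]%g = (s ^ c)%N
    & c = logn s #|X| \/ [/\ s = 2, logn s #|X| = c.+1 & 1 < c]%N.
Proof.
have nBU : U \subset 'N(B) by rewrite cents_norm // subsetIr.
have injB u : u \in U -> coset B u = 1%g -> u = 1%g.
  move=> Uu /coset_idr u1; apply/set1gP; rewrite -[[1 _]%g]tiUB.
  by rewrite inE Uu u1 // (subsetP nBU).
apply: (@free_Sylow_cycle _ p s (U / B)%G).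
- by apply: quotient_abelem; rewrite (abelemS _ abelV) ?subsetIl.
- apply: contra ntU => /eqP W1; apply/trivgPn => -[u Uu ntu].
  move/negP: ntu; apply; apply/eqP; apply: injB => //.
  by apply/set1gP; rewrite -[[1 _]%g]W1 mem_quotient.
- by apply: quotient_norms; exact: sMU.
move=> w /setD1P[ntw /morphimP[u nBu Uu Dw]]; apply/trivgP/subsetP => g /setIP[Xg /cent1P cg].
have [y My Dg] := coset_onto Xg; have [Hy nBy] := setIP My.
have ntu : u != 1%g by apply: contra ntw => /eqP u1; rewrite Dw u1 morph1.
rewrite inE Dg coset_id //; apply: (stab_free Uu ntu Hy).
have Uuy : (u ^ y)%g \in U by rewrite memJ_norm // (subsetP sMU).
rewrite eq_mulgV1; apply/eqP; apply: injB; first by rewrite groupM ?groupV.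
rewrite morphM ?morphV ?morphJ ?groupV ?groupJ //=.
by rewrite -Dg -Dw conjgE -cg mulKg mulgV.
Qed.

Section Orbits.
Variables (Q : nat) (L : {group {unit 'Z_Q}}).
Hypotheses (Q_gt1 : (1 < Q)%N) (dvHQ : (#|H| %| Q)%N).
Hypothesis ratH : forall j z, j \in L -> z \in H -> (z ^+ unat j)%g \in z ^: H.
Local Notation iota := #|[set: {unit 'Z_Q}] : L|.

Let ntV : V :!=: 1%g.
Proof. by apply: contra ntU => /eqP V1; rewrite /= V1 setI1g. Qed.

Let sdvHQ (j : {unit 'Z_Q}) : coprime (unat j) #|H|.
Proof. by rewrite (coprime_dvdr dvHQ) // coprime_unat. Qed.

(** Freeness forces every eigenvalue of [y] on [U] to have the order of the coset of [y]. The
    exponents that occur therefore lie in [L]-orbits of one size [o], with constant multiplicity on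
    each. *)
Lemma quo_spectrum : exists r : gT -> nat -> nat,
  [/\ forall y, y \in M -> (\sum_(a < #|H|) r y a)%N = m,
      forall n, (n %| Q)%N -> exists o i : nat, [/\ (o * i)%N = totient n, (i %| iota)%N &
        forall y, y \in M -> #[coset B y]%g = n ->
          (o %| m)%N /\ (forall a, (a < #|H|)%N -> r y a * o <= m)%N],
      forall y a, y \in M -> (a < #|H|)%N -> r y a != 0%N ->
        #[coset B y]%g = (#|H| %/ gcdn a #|H|)%N
    & forall e, (e %| p.-1)%N -> (e %| #|H|)%N -> exists k : nat,
        (forall t, (k ^ t == 1 %[mod p])%N = (e %| t)%N) /\
        (forall y j, y \in M ->
          #|[set u in U | (u ^ y == u ^+ (k ^ j))%g]| = (p ^ r y (#|H| %/ e * j))%N)].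
Proof.
have solB := solvableS sBH solH.
have [r [r_sum r_rat r_fix r_ord r_card]] := spectrum p_pr abelV ntV nVH (dvdnn _) p'H sBH solB.
have r_supp y a : y \in M -> (a < #|H|)%N -> r y a != 0%N ->
    (#[coset B y]%g == #|H| %/ gcdn a #|H|)%N.
  move=> My lt_a nz_r; apply/exp_orderP => // t; rewrite -coset_exp //.
  apply/idP/idP => [dv_at | Byt]; last exact: r_ord Byt.
  have [Hy nBy] := setIP My.
  have [u] := trivgPn _ (r_fix y a t My nz_r dv_at).
  rewrite /= inE centY inE => /and3P[Vu cyu cBu] ntu.
  apply: (@stab_free u); rewrite ?groupX ?inE ?Vu //.
  by rewrite conjgE (centP cyu) ?mulKg ?cycle_id.
exists r; split=> //; last by move=> y a My lt_a nz_r; apply/eqP/r_supp.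
move=> n dv_nQ; have [o [i [Doi dv_i orb]]] := exp_orbits Q_gt1 L dv_nQ.
exists o, i; split=> // y My oy.
have [|a j Lj lt_a|] := orb #|H| (cardG_gt0 H) (r y) dvHQ; rewrite ?r_sum //.
- by move=> a lt_a; rewrite -oy; apply: r_supp.
by apply: r_rat => // z Hz; apply: ratH.
Qed.

Lemma totient_order_dvd g : g \in X -> (totient #[g]%g %| iota * m)%N.
Proof.
move=> Xg; have [y My Dg] := coset_onto Xg.
have [r [_ r_orb _ _]] := quo_spectrum.
have dv_gQ : (#[g]%g %| Q)%N.
  apply: dvdn_trans (dvdn_trans _ dvHQ); first exact: order_dvdG Xg.
  by rewrite (dvdn_trans (dvdn_quotient _ _)) // cardSg ?subsetIl.
have [o [i [<- dv_i /(_ y My)]]] := r_orb _ dv_gQ; rewrite -Dg => -[] // dv_om _.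
by rewrite mulnC dvdn_mul.
Qed.

End Orbits.

(** Rationality of [u] seen from [H]: as [V] is abelian, conjugation by [V * H] moves [u] only
    through [H], and exponents matter only modulo [p]. *)
Definition rational_vec u := forall k, coprime k p -> exists2 h, h \in H & (u ^ h)%g = (u ^+ k)%g.

Let exp_order_coprime e k : (0 < e)%N ->
  (forall t, (k ^ t == 1 %[mod p])%N = (e %| t)%N) -> coprime k p.
Proof.
move=> e_gt0 ke; have := dvdnn e; rewrite -ke => /eqP k1.
by rewrite -(coprime_pexpl _ _ e_gt0) -coprime_modl k1 coprime_modl coprime1n.
Qed.

Lemma rational_dvd u : u \in U -> u != 1%g -> rational_vec u -> (p.-1 %| #|X|)%N.
Proof.
move=> Uu ntu rat_u; have [k ke] := prim_root_mod p_pr.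
have co_kp : coprime k p by apply: exp_order_coprime ke; rewrite -subn1 subn_gt0 prime_gt1.
have [h Hh Duh] := rat_u k co_kp; have Mh := mult_norm Uu ntu Hh co_kp Duh.
by rewrite -(mult_order Uu ntu Mh Duh ke) order_dvdG // mem_quotient.
Qed.

Local Open Scope nat_scope.
Section Count.
Variables (Q : nat) (L : {group {unit 'Z_Q}}).
Hypotheses (Q_gt1 : (1 < Q)%N) (dvHQ : (#|H| %| Q)%N).
Hypothesis ratH : forall j z, j \in L -> z \in H -> (z ^+ unat j)%g \in z ^: H.

(** Double count of pairs ([u], [y]) with [u] in [R] and [u ^ y = u ^+ (k ^ j)]. For each of the
    [o * i] exponents of order [e], every [u] yields a full coset of [B]. For each [y] of order [e]
    modulo [B], the multiplicities are at most [D = m %/ o] with sum at most [m], so by convexity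
    [y] accounts for at most [o * (p ^ D).-1] pairs. The factors [o] and [#|B|] cancel. *)
Lemma rational_count (R : {set gT}) e : (e %| p.-1)%N -> R != set0 -> R \subset U^# ->
    (forall u, u \in R -> rational_vec u) ->
  exists o i : nat, [/\ (o * i)%N = totient e, (i %| #|[set: {unit 'Z_Q}] : L|)%N, (o %| m)%N
    & (#|R| * i <= #|[set g in X | #[g]%g == e]| * (p ^ (m %/ o)).-1)%N].
Proof.
move=> dv_ep ntR sRU ratR; have p_gt1 := prime_gt1 p_pr.
have RP u : u \in R -> [/\ u \in U, u != 1%g & rational_vec u].
  by move=> Ru; have /setD1P[] := subsetP sRU u Ru; split=> //; apply: ratR.
have [u0 Ru0] := set0Pn _ ntR; have [Uu0 ntu0 rat0] := RP u0 Ru0.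
have dv_eX := dvdn_trans dv_ep (rational_dvd Uu0 ntu0 rat0).
have dv_XH : (#|X| %| #|H|)%N by rewrite (dvdn_trans (dvdn_quotient _ _)) // cardSg ?subsetIl.
have dv_eH := dvdn_trans dv_eX dv_XH; have dv_eQ := dvdn_trans dv_eH dvHQ.
have e_gt0 : (0 < e)%N by rewrite (dvdn_gt0 _ dv_ep) // -subn1 subn_gt0.
have [r [r_sum r_orb r_ord r_card]] := quo_spectrum Q_gt1 dvHQ ratH.
have [k [ke k_card]] := r_card e dv_ep dv_eH.
have co_kp := exp_order_coprime e_gt0 ke.
have [o [i [Doi dv_i orb]]] := r_orb e dv_eQ; exists o, i.
have [h0 Hh0 Duh0] := rat0 k co_kp; have Mh0 := mult_norm Uu0 ntu0 Hh0 co_kp Duh0.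
have [dv_om _] := orb h0 Mh0 (mult_order Uu0 ntu0 Mh0 Duh0 ke).
split=> //; set D := (m %/ o)%N; pose N := #|H|.
have Dm : m = (D * o)%N by rewrite divnK.
have o_gt0 : (0 < o)%N by apply: dvdn_gt0 m_gt0 dv_om.
have D_gt0 : (0 < D)%N by rewrite divn_gt0 // dvdn_leq ?m_gt0.
pose Me := [set y in M | #[coset B y]%g == e].
pose S := [set a : 'I_N | e == N %/ gcdn a N]%N.
have cardS : #|S| = totient e by apply: card_exp_order dv_eH; apply: cardG_gt0.
have cardMe : #|Me| = (#|[set g in X | #[g]%g == e]| * #|B|)%N.
  apply: (@card_coset_pred _ M B [pred g | #[g]%g == e]).
  rewrite /normal subsetIr andbT subsetI sBH normG.
  by [].
have countS (a : 'I_N) : a \in S -> (#|R| * #|B| <= \sum_(y in Me) (p ^ r y a).-1)%N.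
  rewrite inE => Sa; have [j Da] : exists j, val a = (N %/ e * j)%N.
    exists (a %/ (N %/ e))%N; rewrite mulnC divnK //.
    by rewrite (eqP Sa) divnA ?dvdn_gcdr // mulKn ?dvdn_gcdl ?cardG_gt0.
  pose T y := [set u in U | (u != 1)%g && (u ^ y == u ^+ (k ^ j))%g].
  have TE y : y \in M -> #|T y| = (p ^ r y a).-1.
    move=> My; rewrite Da -k_card // [in RHS](cardsD1 1%g) inE group1 conj1g expg1n eqxx /=.
    by apply: eq_card => u; rewrite !inE; case: (u != 1%g); rewrite ?andbF.
  (* By [r_ord], elements of another order modulo [B] have multiplicity 0 at [a]. *)
  have sum_T : (\sum_(y in M) #|T y| <= \sum_(y in Me) (p ^ r y a).-1)%N.
    rewrite [leqRHS]big_mkcond [leqLHS]big_mkcond /=; apply: leq_sum => y _.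
    rewrite [y \in Me]inE; case: ifP => //= My; rewrite TE //; case: ifP => // ney.
    rewrite leqn0; apply/contraFT: ney => nz_r.
    rewrite (r_ord y a My (ltn_ord a)) ?(eqP Sa) //.
    by apply: contraNneq nz_r => ->; rewrite expn0.
  apply: leq_trans sum_T; rewrite -sum_nat_const.
  under [leqRHS]eq_bigr => y My do rewrite -sum1_card big_mkcond /=.
  rewrite exchange_big /= big_mkcond /=; apply: leq_sum => u _; case: ifP => // Ru.
  have [Uu ntu rat_u] := RP u Ru.
  have co_kjp : coprime (k ^ j) p by rewrite coprimeXl.
  have [h Hh Duh] := rat_u _ co_kjp; have Mh := mult_norm Uu ntu Hh co_kjp Duh.
  rewrite -(card_rcoset B h) -sum1_card big_mkcond [leqRHS]big_mkcond /=; apply: leq_sum => y _.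
  case: ifP => // /rcosetP[b Bb ->].
  have Mb : b \in M by rewrite inE (subsetP sBH) // (subsetP (normG B)).
  rewrite groupM // inE Uu ntu /= conjgM.
  have ub : (u ^ b)%g = u.
    by have [_ /centP cBu] := setIP Uu; rewrite conjgE cBu ?mulKg.
  by rewrite ub Duh eqxx.
have inner y : y \in Me -> (\sum_(a in S) (p ^ r y a).-1 <= o * (p ^ D).-1)%N.
  rewrite inE => /andP[My /eqP oy]; have [_ le_r] := orb y My oy.
  rewrite -(leq_pmul2r D_gt0) big_distrl /=.
  apply: (@leq_trans (\sum_(a in S) r y a * (p ^ D).-1)).
    apply: leq_sum => a _; apply: expn_convex; first exact: ltnW.
    by rewrite -(leq_pmul2r o_gt0) -Dm le_r.
  rewrite -big_distrl /= mulnAC leq_mul // mulnC -Dm -(r_sum y My) big_mkcond /=.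
  by apply: leq_sum => a _; case: ifP.
have oB_gt0 : (0 < o * #|B|)%N by rewrite muln_gt0 o_gt0 cardG_gt0.
rewrite -(leq_pmul2r oB_gt0).
have -> : (#|R| * i * (o * #|B|) = \sum_(a in S) #|R| * #|B|)%N.
  by rewrite sum_nat_const cardS -Doi mulnACA [RHS]mulnACA [(o * #|R|)%N]mulnC.
apply: (@leq_trans (\sum_(a in S) \sum_(y in Me) (p ^ r y a).-1)); first exact: leq_sum.
rewrite exchange_big /=; apply: (@leq_trans (\sum_(y in Me) o * (p ^ D).-1)); first exact: leq_sum.
by rewrite sum_nat_const cardMe mulnACA [leqRHS]mulnACA [(_ * #|B|)%N]mulnC.
Qed.

Hypothesis piH : forall s, prime s -> s %| #|H| -> s \in [:: 2; 3; 5; 7].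
Local Notation iota := #|[set: {unit 'Z_Q}] : L|.

Let dvXH : #|X| %| #|H|.
Proof. by rewrite (dvdn_trans (dvdn_quotient _ _)) // cardSg ?subsetIl. Qed.

Let X_totient s : prime s -> s %| #|X| ->
  exists2 c, totient (s ^ c) %| iota * m
    & c = logn s #|X| \/ [/\ s = 2, logn s #|X| = c.+1 & 1 < c].
Proof.
move=> s_pr /(quo_Sylow_cycle s_pr)[c [g Xg og] Dc]; exists c => //.
by rewrite -og (totient_order_dvd Q_gt1 dvHQ ratH).
Qed.

Let X_dvd_pred s : prime s -> s != 2 -> s %| #|X| -> s.-1 %| iota * m.
Proof.
move=> s_pr s_neq2 dvs; have [c dvt [Dc | [s2]]] := X_totient s_pr dvs; last by rewrite s2 in s_neq2.
have c_gt0 : 0 < c by rewrite Dc logn_gt0 mem_primes s_pr cardG_gt0.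
by apply: dvdn_trans dvt; rewrite totient_pfactor // dvdn_mulr.
Qed.

Let X_dvd4 : 4 %| #|X| -> 2 %| iota * m.
Proof.
move=> dv4; have dv2 : 2 %| #|X| by apply: dvdn_trans dv4.
have [c dvt Dc] := X_totient (isT : prime 2) dv2; apply: dvdn_trans dvt.
have c_gt1 : 1 < c by case: Dc => [-> | []] //; rewrite -pfactor_dvdn ?cardG_gt0.
by rewrite totient_pfactor ?(ltnW c_gt1) // mul1n; case: c c_gt1 {Dc} => [|[|c]] // _; rewrite expnS dvdn_mulr.
Qed.

(** 420 is 4 * 3 * 5 * 7, and [s ^ c] divides [s] times its totient. In the exceptional case
    [2 ^ c.+1] is 4 times the totient of [2 ^ c], whence the factor 4. *)
Let X_dvd420 : #|X| %| 420 * (iota * m).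
Proof.
apply/dvdn_partP => [|s]; first exact: cardG_gt0.
rewrite mem_primes => /and3P[s_pr _ dvs]; rewrite p_part.
have [c dvt Dc] := X_totient s_pr dvs.
have logX_gt0 : 0 < logn s #|X| by rewrite logn_gt0 mem_primes s_pr cardG_gt0.
case: Dc => [Dc | [s2 -> c_gt1]].
  have s_dv : s %| 420.
    by have := piH s_pr (dvdn_trans dvs dvXH); rewrite !inE => /or4P[] /eqP->.
  rewrite -Dc in logX_gt0 *; rewrite -(prednK logX_gt0) expnS dvdn_mul //.
  by apply: dvdn_trans dvt; rewrite totient_pfactor // dvdn_mull.
rewrite s2 in dvt *; rewrite -(prednK (ltnW c_gt1)) !expnS mulnA dvdn_mul //.
by apply: dvdn_trans dvt; rewrite totient_pfactor ?mul1n // ltnW.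
Qed.

Lemma full_false : 11 <= p -> iota <= 3 ->
  (forall u, u \in U -> u != 1%g -> rational_vec u) -> False.
Proof.
move=> p_ge le3 ratU; pose Ne e := #|[set g in X | #[g]%g == e]|.
have cardU1 : #|U^#| = (p ^ m).-1 by rewrite -cardU (cardsD1 1%g U) group1.
have ntU1 : U^# != set0 by rewrite -card_gt0 cardU1 -subn1 subn_gt0 -(expn0 p) ltn_exp2l ?prime_gt1 ?m_gt0.
have full e : e %| p.-1 -> exists o i, [/\ o * i = totient e, i %| iota, o %| m
    & (p ^ m).-1 * i <= Ne e * (p ^ (m %/ o)).-1].
  move=> dv_e; have [|o [i [? ? ? ?]]] := rational_count dv_e ntU1 (subxx _).
    by move=> u /setD1P[ntu Uu]; apply: ratU.
  by exists o, i; rewrite -cardU1.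
have sumN e e' : e != e' -> Ne e + Ne e' <= #|X|.
  move=> ne_e; rewrite /Ne -cardsUI.
  have -> : [set g in X | #[g]%g == e] :&: [set g in X | #[g]%g == e'] = set0.
    apply/setP => g; rewrite !inE; apply/negP => /andP[/andP[_ oe] /andP[_ oe']].
    by move: ne_e; rewrite -(eqP oe) (eqP oe') eqxx.
  rewrite cards0 addn0; apply/subset_leq_card/subsetP => g; rewrite !inE -andb_orr.
  by case/andP.
have iota_bnd : 0 < iota <= 3 by rewrite indexg_gt0.
have dv57 s : s \in [:: 5; 7] -> s %| #|X| -> s.-1 %| iota * m.
  by rewrite !inE => /orP[] /eqP-> ; apply: X_dvd_pred.
have [p11 m2 N5 N10] := full_numeric p_pr p_ge m_gt0 (cardG_gt0 X) card_quo_dvd X_dvd420 iota_bnd dv57 full sumN.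
have x_ge : 48 <= #|X| by apply: leq_trans (@sumN 5 10 isT); rewrite (leq_add N5 N10).
have dvX120 : #|X| %| 120 by have := card_quo_dvd; rewrite m2 p11.
(* The divisors of 120 from 48 on are 60 and 120. *)
have dv15 : 15 %| #|X|.
  have := dvdn_check (isT : 0 < 120) dvX120 (_ : all (fun d => (48 <= d) ==> (15 %| d)) _).
  by move=> /(_ isT); rewrite x_ge.
have := leq_trans N5 (solvable_card_order5 (quotient_sol _ (solvableS (subsetIl _ _) solH)) dvX120 dv15).
by [].
Qed.

(** With [iota = 1] the orbit size [o] is the whole totient of [p.-1], at least 4 for [p >= 11]; so
    [rational_count] bounds [R] with [D] at most a quarter of [m]. *)
Lemma rational_scarce (R : {set gT}) : 11 <= p -> iota = 1%N -> R \subset U^# ->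
  (forall u, u \in R -> rational_vec u) -> 3 * #|X| < #|U^# :\: R|.
Proof.
move=> p_ge iota1 sRU ratR.
have [D [D_le leR]] : exists D, 4 * D <= m /\ #|R| <= #|X| * (p ^ D).-1.
  have [-> | ntR] := eqVneq R set0; first by exists 0; rewrite cards0 muln0.
  have [o [i [Doi dv_i dv_om leRN]]] := rational_count (dvdnn _) ntR sRU ratR.
  move: dv_i; rewrite iota1 dvdn1 => /eqP i1; rewrite i1 !muln1 in Doi leRN.
  exists (m %/ o); split; last first.
    apply: leq_trans leRN _; rewrite leq_mul2r; apply/orP; right.
    by apply: subset_leq_card; apply/subsetP => g; rewrite inE => /andP[].
  rewrite -[leqRHS](divnK dv_om) mulnC leq_mul2l Doi.
  have [/totient_big/andP[tot8 _] | le18] := ltnP 18 p.-1; first by rewrite (leq_trans _ tot8) ?orbT.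
  have : p.-1 \in seq.iota 10 9 by rewrite mem_iota; move: p_ge le18; clear; lia.
  have : all (fun n => 4 <= totient n) (seq.iota 10 9) by vm_compute.
  by move=> /allP tot4 /tot4 ->; rewrite orbT.
have cardU1 : #|U^#| = (p ^ m).-1 by rewrite -cardU (cardsD1 1%g U) group1.
rewrite cardsD (setIidPr sRU) cardU1.
have x_gt0 : 0 < #|X| := cardG_gt0 X.
have pD_gt0 : 0 < p ^ D by rewrite expn_gt0 prime_gt0.
have lt_num : #|X| * (2 + p ^ D) < (p ^ m).-1.
  apply: (free_numeric p_ge m_gt0 _ _ _ D_le); first by have := X_dvd420; rewrite iota1 mul1n.
    move=> s s_in dvs; have := X_dvd_pred _ _ dvs; rewrite iota1 mul1n.
    by move: s_in; rewrite !inE => /or3P[] /eqP ->; apply.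
  by have := X_dvd4; rewrite iota1 mul1n.
move: leR lt_num pD_gt0; rewrite -subn1 mulnBr mulnDr muln1 -(leq_add2r #|X|).
move: (_ ^ D) (_.-1) #|R| #|X| => a b c x.
by clear; nia.
Qed.

End Count.

End FreeQuotient.
Local Open Scope ring_scope.

(** * Nonrational classes *)

(** Restricted to the cyclic group of [x], the character is a sum of linear ones, whose values are
    roots of unity that [u] raises to the power [j]. *)
Lemma cfun_exp_aut (gT : finGroupType) (G : {group gT}) (chi : 'CF(G)) x j
    (u : {rmorphism algC -> algC}) :
    chi \is a character -> x \in G -> (forall z, z ^+ #|G| = 1 -> u z = z ^+ j) ->
  chi (x ^+ j)%g = u (chi x).
Proof.
move=> Nchi Gx Du; have sxG : <[x]> \subset G by rewrite cycle_subG.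
have xx := cycle_id x; have xj : (x ^+ j)%g \in <[x]>%g by rewrite groupX.
rewrite -!(cfResE chi sxG) // ['Res[_] chi]cfun_sum_cfdot !sum_cfunE rmorph_sum.
apply: eq_bigr => i _; rewrite !cfunE rmorphM /= aut_natr ?Cnat_cfdot_char_irr ?cfRes_char //.
have lin_i := elimT (char_abelianP <[x]>%G) (cycle_abelian x) i.
rewrite lin_charX // Du // -[#|G|](divnK (order_dvdG Gx)) mulnC exprM.
by rewrite lin_char_unity_root // expr1n.
Qed.

Section RationalElements.
Variables (gT : finGroupType) (G : {group gT}).

Definition nonrational (x : gT) :=
  [exists j : 'I_#|G|, coprime j #|G| && ((x ^+ j)%g \notin x ^: G)].

Definition nonrational_classes := [set (x ^: G)%g | x in G & nonrational x].

Lemma rationalP x : x \in G ->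
  reflect (forall j, coprime j #|G| -> (x ^+ j)%g \in x ^: G) (~~ nonrational x).
Proof.
move=> Gx; rewrite negb_exists; apply: (iffP forallP) => [ratx j co_j | ratx j].
  have lt_j : (j %% #|G| < #|G|)%N by rewrite ltn_mod.
  have := ratx (Ordinal lt_j); rewrite /= coprime_modl co_j negbK.
  by rewrite expg_mod // expg_cardG.
by rewrite negb_and negbK -implybE; apply/implyP/ratx.
Qed.

Lemma nonrational_irrational x : x \in G -> nonrational x -> x ^: G \in irrational_classes G.
Proof.
move=> Gx; apply: contraLR => rat_xG; apply/(rationalP Gx) => j co_j.
apply/eq_irr_mem_classP => // i.
have [u Du] := Qn_aut_exists co_j; rewrite (cfun_exp_aut (irr_char i) Gx Du) aut_Crat //.
have [y Gy Dy] := repr_class G x.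
move: rat_xG; rewrite inE mem_classes // negb_exists => /forallP/(_ i).
by rewrite negbK Dy cfunJ.
Qed.

Lemma card_nonrational_le : (#|nonrational_classes| <= #|irrational_classes G|)%N.
Proof.
apply/subset_leq_card/subsetP => _ /imsetP[x /setIdP[Gx nratx] ->].
exact: nonrational_irrational.
Qed.

End RationalElements.

(** An exponent prime to the order of the quotient lifts to one prime to [#|G|], so images of
    rational elements are rational, and each nonrational class of the quotient comes from one of
    [G]. *)
Lemma nonrational_quotient (gT : finGroupType) (G V : {group gT}) :
  V <| G -> (#|nonrational_classes (G / V)| <= #|nonrational_classes G|)%N.
Proof.
move=> nsVG; have [sVG nVG] := andP nsVG.
apply: leq_trans (leq_imset_card (fun K => K / V)%g _); apply/subset_leq_card/subsetP => K.
case/imsetP => _ /setIdP[/morphimP[x nVx Gx ->] nratx] ->.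
apply/imsetP; exists (x ^: G); last by rewrite quotient_class.
apply/imsetP; exists x => //; rewrite inE Gx /=; apply: contraLR nratx => ratx.
apply/(rationalP (mem_quotient V Gx)) => j co_j.
have [b co_b Db] := coprime_lift (cardG_gt0 G) (dvdn_quotient G V) co_j.
have /imsetP[y Gy Dxb] := elimT (rationalP Gx) ratx b co_b.
have nVy := subsetP nVG y Gy.
rewrite -(expg_mod j (expg_cardG (mem_quotient V Gx))) -Db expg_mod ?expg_cardG ?mem_quotient //.
by rewrite -morphX // Dxb morphJ // memJ_class // mem_quotient.
Qed.

(** * The Galois action on conjugacy classes *)

Section GaloisClasses.
Variables (gT : finGroupType) (G : {group gT}).
Hypothesis G_gt1 : (1 < #|G|)%N.
Local Notation uT := {unit 'Z_#|G|}.

Lemma expg_unatM (x : gT) (j k : uT) : x \in G ->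
  (x ^+ unat (j * k)%g)%g = ((x ^+ unat j) ^+ unat k)%g.
Proof. by move=> Gx; rewrite unatM // expg_mod ?expg_cardG // expgM. Qed.

Lemma expg_unatC (x : gT) (j k : uT) : ((x ^+ unat j) ^+ unat k)%g = ((x ^+ unat k) ^+ unat j)%g.
Proof. by rewrite -!expgM mulnC. Qed.

Lemma expg_unatK (x : gT) (j : uT) : x \in G -> ((x ^+ unat j) ^+ unat (j^-1)%g)%g = x.
Proof. by move=> Gx; rewrite -expg_unatM // mulgV unat1. Qed.

Lemma class_expg (x y : gT) n : x \in (y ^: G)%g -> (x ^+ n)%g \in ((y ^+ n) ^: G)%g.
Proof. by case/imsetP=> z Gz ->; rewrite -conjXg memJ_class. Qed.

Lemma class_eq_trans (x y z : gT) : x \in (y ^: G)%g -> y \in (z ^: G)%g -> x \in (z ^: G)%g.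
Proof. by move=> xy /class_eqP <-. Qed.

Lemma class_expgK (x y : gT) (j : uT) : x \in G -> y \in G ->
  (x ^+ unat j)%g \in (y ^: G)%g -> x \in ((y ^+ unat (j^-1)%g) ^: G)%g.
Proof. by move=> Gx Gy /(class_expg (unat (j^-1)%g)); rewrite expg_unatK. Qed.

(** The stabilizer of the class of [x] under the Galois action. *)
Definition rational_units (x : gT) : {set uT} := [set j | (x ^+ unat j)%g \in (x ^: G)%g].

Lemma rational_units_group_set x : x \in G -> group_set (rational_units x).
Proof.
move=> Gx; apply/group_setP; split=> [|j k]; first by rewrite inE unat1 // expg1 class_refl.
rewrite !inE => xj xk; rewrite expg_unatM //.
exact: class_eq_trans (class_expg _ xj) xk.
Qed.

Lemma nonrational_unit x : x \in G -> nonrational G x ->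
  exists j : uT, (x ^+ unat j)%g \notin (x ^: G)%g.
Proof.
move=> Gx /existsP[a /andP[co_a xa]]; have [j Dj] := unat_onto G_gt1 co_a.
by exists j; rewrite -(expg_mod _ (expg_cardG Gx)) Dj expg_mod ?expg_cardG.
Qed.

Lemma nonrational_exp x (j : uT) : x \in G -> nonrational G x -> nonrational G (x ^+ unat j)%g.
Proof.
move=> Gx; apply: contraLR => /(rationalP (groupX _ Gx)) rat_xj.
apply/(rationalP Gx) => k co_k.
have xj : x \in ((x ^+ unat j) ^: G)%g.
  by rewrite -{1}(expg_unatK j Gx) rat_xj ?coprime_unat.
rewrite -{1}(expg_unatK j Gx) -expgM (class_eqP xj) rat_xj //.
by rewrite coprimeMl coprime_unat.
Qed.

Lemma rational_units_index x (L : {group uT}) : x \in G -> nonrational G x ->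
  L = rational_units x :> {set uT} -> (#|[set: uT] : L| <= #|nonrational_classes G|)%N.
Proof.
move=> Gx nratx DL; pose f (K : {set uT}) := ((x ^+ unat (repr K)) ^: G)%g.
have injf : {in rcosets L [set: uT] &, injective f}; last rewrite -[leqLHS](card_in_imset injf).
  move=> _ _ /rcosetsP[j _ ->] /rcosetsP[k _ ->] eq_f.
  rewrite -(rcoset_repr L j) -(rcoset_repr L k); apply/rcoset_eqP; move: eq_f; rewrite /f.
  move: (repr (L :* j)%g) (repr (L :* k)%g) => a b eq_ab; rewrite mem_rcoset DL inE expg_unatM //.
  have /(class_expg (unat b^-1%g)) : (x ^+ unat a)%g \in ((x ^+ unat b) ^: G)%g.
    by rewrite -eq_ab class_refl.
  by rewrite expg_unatK.
apply/subset_leq_card/subsetP => _ /imsetP[K _ ->].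
by apply/imsetP; exists (x ^+ unat (repr K))%g => //; rewrite inE groupX ?nonrational_exp.
Qed.

Hypothesis few : (#|nonrational_classes G| <= 3)%N.

(** Otherwise [x], [x ^+ unat a], [y] and [y ^+ unat b] would lie in four distinct nonrational
    classes. *)
Lemma nonrational_orbit x y : x \in G -> nonrational G x -> y \in G -> nonrational G y ->
  exists j : uT, y \in ((x ^+ unat j) ^: G)%g.
Proof.
move=> Gx nratx Gy nraty.
have [/existsP // | ] := boolP [exists j : uT, y \in ((x ^+ unat j) ^: G)%g].
rewrite negb_exists => /forallP xy; exfalso.
have [a xa] := nonrational_unit Gx nratx; have [b yb] := nonrational_unit Gy nraty.
have sep (j k : uT) : ((x ^+ unat j) ^: G)%g != ((y ^+ unat k) ^: G)%g.
  apply/negP => /eqP/esym/class_eqP/(class_expgK Gy (groupX _ Gx)).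
  by rewrite -expg_unatM // => yx; have := xy (j * k^-1)%g; rewrite yx.
pose s := [:: x ^: G; (x ^+ unat a) ^: G; y ^: G; (y ^+ unat b) ^: G]%g.
have us : uniq s.
  have := (sep 1%g 1%g, sep 1%g b, sep a 1%g, sep a b); rewrite !unat1 // !expg1 => -[[[s1 s2] s3] s4].
  rewrite /s /= !inE !negb_or s1 s2 s3 s4 !andbT /=.
  by rewrite ![(_ == (_ ^+ _) ^: G)%g]eq_sym; apply/andP; split; apply/eqP => /class_eqP; apply/negP.
suff /(uniq_leq_size us) : {subset s <= enum (nonrational_classes G)}.
  by rewrite -cardE => /leq_trans/(_ few).
move=> K; rewrite mem_enum !inE => /or4P[] /eqP->; apply/imset_f; rewrite inE ?groupX ?Gx ?Gy //=;
  by rewrite ?nonrational_exp.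
Qed.

(** The stabilizer of one nonrational class fixes all the others, because they form a single orbit
    of a commutative group; its index is bounded by their number. *)
Lemma rational_units_exist : exists L : {group uT}, (#|[set: uT] : L| <= 3)%N /\
  forall j x, j \in L -> x \in G -> (x ^+ unat j)%g \in (x ^: G)%g.
Proof.
have [/existsP[x0 /andP[Gx0 nratx0]] | ratG] := boolP [exists x, (x \in G) && nonrational G x].
  exists (Group (rational_units_group_set Gx0)); split.
    by apply: leq_trans few; apply: (rational_units_index Gx0 nratx0).
  move=> j x; rewrite inE => x0j Gx; have [nratx | /(rationalP Gx)] := boolP (nonrational G x); last first.
    by apply; rewrite coprime_unat.
  have [a xa] := nonrational_orbit Gx0 nratx0 Gx nratx.
  rewrite (class_eqP xa); apply: class_eq_trans (class_expg _ xa) _.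
  by rewrite expg_unatC class_expg.
exists [set: uT]%G; rewrite indexgg; split=> // j x _ Gx.
move: ratG; rewrite negb_exists => /forallP/(_ x); rewrite Gx => /(rationalP Gx); apply.
exact: coprime_unat.
Qed.

End GaloisClasses.

(** * Minimal counterexamples *)

(** Write the conjugating element as [v * w]. Then [h ^+ j] and [h ^ w] both lie in [H] and agree
    modulo [V], hence are equal. *)
Lemma complement_class (gT : finGroupType) (G V H : {group gT}) h j :
    V <| G -> (V * H = G)%g -> (V :&: H = 1)%g -> h \in H ->
  (h ^+ j)%g \in (h ^: G)%g -> (h ^+ j)%g \in (h ^: H)%g.
Proof.
move=> /andP[sVG nVG] defG tiVH Hh /imsetP[g]; rewrite -defG => /mulsgP[v w Vv Hw ->] Dhj.
have sHG : H \subset G by rewrite -defG mulG_subr.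
have nVh z : z \in H -> z \in 'N(V) by move=> Hz; rewrite (subsetP nVG) ?(subsetP sHG).
apply/imsetP; exists w => //.
have Nh := nVh h Hh; have Nw := nVh w Hw; have Nv : v \in 'N(V) := subsetP (normG V) v Vv.
have Nx : (h ^+ j * (h ^ w)^-1)%g \in 'N(V) by rewrite groupM ?groupV ?groupX ?groupJ.
apply/eqP; rewrite eq_mulgV1 -in_set1 -[[set 1]%g]tiVH inE.
rewrite [X in _ && X]groupM ?groupV ?groupX ?groupJ // andbT; apply: coset_idr => //.
have hv : coset V (h ^ v)%g = coset V h by rewrite morphJ //= (coset_id Vv) conjg1.
have -> : (h ^+ j * (h ^ w)^-1 = ((h ^ v) * h^-1) ^ w)%g by rewrite Dhj conjgM -conjVg -conjMg.
have Nhv : (h ^ v)%g \in 'N(V) by rewrite groupJ.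
have Nhi : (h^-1)%g \in 'N(V) by rewrite groupV.
have Nhh : (h ^ v * h^-1)%g \in 'N(V) by apply: groupM.
by rewrite morphJ // morphM //= hv morphV //= mulgV conj1g.
Qed.

Section MinimalCase.
Variables (gT : finGroupType) (p : nat) (G V H : {group gT}).
Hypotheses (p_pr : prime p) (p_ge11 : (11 <= p)%N) (solG : solvable G).
Hypotheses (nsVG : V <| G) (abelV : p.-abelem V) (ntV : V :!=: 1%g).
Hypotheses (defG : (V * H = G)%g) (tiVH : (V :&: H = 1)%g) (p'H : ~~ (p %| #|H|)%N).
Hypothesis piH : forall s, prime s -> (s %| #|H|)%N -> s \in [:: 2; 3; 5; 7]%N.
Hypothesis few : (#|nonrational_classes G| <= 3)%N.

Let sVG : V \subset G. Proof. exact: normal_sub. Qed.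
Let sHG : H \subset G. Proof. by rewrite -defG mulG_subr. Qed.
Let nVH : H \subset 'N(V). Proof. by apply: subset_trans sHG _; apply: normal_norm. Qed.
Let solH : solvable H. Proof. exact: solvableS solG. Qed.
Let dvHG : (#|H| %| #|G|)%N. Proof. exact: cardSg. Qed.
Let p_gt0 : (0 < p)%N. Proof. exact: prime_gt0. Qed.
Let dvpG : (p %| #|G|)%N.
Proof.
apply: dvdn_trans (cardSg sVG).
by have [_ dvpV _] := pgroup_pdiv (abelem_pgroup abelV) ntV.
Qed.
Let G_gt1 : (1 < #|G|)%N.
Proof. by rewrite (leq_trans (prime_gt1 p_pr)) // dvdn_leq ?cardG_gt0. Qed.

Let classV v x : v \in V -> x \in (v ^: G)%g -> exists2 h, h \in H & x = (v ^ h)%g.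
Proof.
move=> Vv /imsetP[g]; rewrite -defG => /mulsgP[w h Vw Hh ->] ->; exists h => //.
have cVV := abelem_abelian abelV.
have vw : (v ^ w)%g = v by rewrite conjgE (centsP cVV v Vv w Vw) mulKg.
by rewrite conjgM vw.
Qed.

Let rational_vecV v : v \in V -> ~~ nonrational G v -> rational_vec p H v.
Proof.
move=> Vv /(rationalP (subsetP sVG v Vv)) rat_v k co_kp.
have [b co_b Db] := coprime_lift (cardG_gt0 G) dvpG co_kp.
have vp : (v ^+ p)%g = 1%g by have [_ ->] := abelemP p_pr abelV.
have [h Hh Dh] := classV Vv (rat_v b co_b); exists h => //.
by rewrite -Dh -(expg_mod _ vp) Db expg_mod.
Qed.

(** The stabilizer of a nontrivial [v] in ['C_V(B)] contains [B], so maximality of [#|B|] gives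
    equality. *)
Let max_stab : exists B : {group gT}, [/\ B \subset H, 'C_V(B)%G :!=: 1%g
  & forall u, u \in 'C_V(B)%G -> u != 1%g -> 'C_H[u]%g = B].
Proof.
have [u0 Vu0 ntu0] := trivgPn _ ntV.
have P0 : (u0 \in V) && (u0 != 1%g) by rewrite Vu0.
case: (@arg_maxnP _ u0 (fun u => (u \in V) && (u != 1%g)) (fun u => #|'C_H[u]%g|) P0) => u /andP[Vu ntu] max_u.
exists 'C_H[u]%G; split; first exact: subsetIl.
  apply/trivgPn; exists u => //; rewrite inE Vu /=.
  by apply/centP => z /setIP[_ /cent1P].
move=> v /setIP[Vv cv] ntv; apply/esym/eqP; rewrite eqEcard [X in _ && X]max_u ?Vv //= andbT.
rewrite subsetI subsetIl /=; apply/subsetP => z Bz; apply/cent1P.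
by apply/esym/(centP cv).
Qed.

Lemma minimal_false : False.
Proof.
have [B [sBH ntU freeB]] := max_stab.
have sUV : 'C_V(B)%G \subset V by apply: subsetIl.
have [ratV | ] := boolP [forall v in V, ~~ nonrational G v].
  have [L [L_le3 ratL]] := rational_units_exist G_gt1 few.
  apply: (@full_false _ p V H B p_pr abelV nVH p'H solH sBH ntU freeB _ L G_gt1 dvHG _ piH p_ge11 L_le3).
    move=> j z Lj Hz; apply: (complement_class nsVG defG tiVH Hz).
    by apply: ratL => //; apply: (subsetP sHG).
  move=> u /(subsetP sUV) Vu _; apply: rational_vecV => //.
  by apply: (forall_inP ratV).
rewrite negb_forall => /existsP[v0]; rewrite negb_imply negbK => /andP[Vv0 nrat0].
have Gv0 := subsetP sVG v0 Vv0.
(* All nonrational classes are Galois conjugates of the class of [v0], and [V] is normal. *)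
have nratV y : y \in G -> nonrational G y -> y \in V.
  move=> Gy nraty; have [j /imsetP[g Gg ->]] := nonrational_orbit G_gt1 few Gv0 nrat0 Gy nraty.
  by rewrite memJ_norm ?groupX // (subsetP (normal_norm nsVG)).
have ratH (j : {unit 'Z_#|G|}) z : j \in [set: {unit 'Z_#|G|}]%G -> z \in H -> (z ^+ unat j)%g \in (z ^: H)%g.
  move=> _ Hz; apply: (complement_class nsVG defG tiVH Hz); have Gz := subsetP sHG z Hz.
  have [Vz | V'z] := boolP (z \in V).
    have -> : z = 1%g by apply/set1gP; rewrite -[[1]%g]tiVH inE Vz.
    by rewrite expg1n class_refl.
  by apply: (rationalP Gz); rewrite ?coprime_unat //; apply: contra V'z; apply: nratV.
(* If [c] is nontrivial, [v * c] lies outside [V], hence is rational, and then so is its power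
   [v]. *)
have freeV v c : v \in V -> nonrational G v -> c \in 'C_H[v]%g -> c = 1%g.
  move=> Vv nrat_v /setIP[Hc /cent1P cvc]; apply/eqP; apply: contraLR nrat_v => ntc.
  have Gv := subsetP sVG v Vv; have Gc := subsetP sHG c Hc; have Gvc := groupM Gv Gc.
  have ratvc : ~~ nonrational G (v * c)%g.
    apply: contra ntc => /(nratV _ Gvc); rewrite groupMl // => Vc.
    by rewrite -in_set1 -[[set 1]%g]tiVH inE Vc.
  have co_pH : coprime p #|H| by rewrite prime_coprime.
  (* [e] is 1 modulo [p] and 0 modulo [#|H|]: this power keeps [v] and kills [c]. *)
  pose e := chinese p #|H| 1 0.
  have vce : ((v * c) ^+ e)%g = v.
    have [_ /(_ v Vv) vp] := abelemP p_pr abelV.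
    rewrite expgMn // -(expg_mod e vp) chinese_modl // (expg_mod 1 vp) expg1.
    by rewrite -(expg_mod e (expg_cardG Hc)) chinese_modr // mod0n mulg1.
  apply/(rationalP Gv) => b co_b; have /(class_expg e) := elimT (rationalP Gvc) ratvc b co_b.
  by rewrite expgAC vce.
(* For trivial [B], [X] has order [#|H|], and at most 3 nonrational classes of at most [#|H|]
   elements contradict [rational_scarce]. For nontrivial [B], [freeV] makes all of [U] rational. *)
have [B1 | ntB] := eqVneq (B : {set gT}) 1%g.
  have iota1 : #|[set: {unit 'Z_#|G|}] : [set: {unit 'Z_#|G|}]%G| = 1%N by rewrite indexgg.
  pose R := [set u in 'C_V(B)^# | ~~ nonrational G u].
  have sR : R \subset 'C_V(B)%G^# by apply/subsetP => u /setIdP[].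
  have ratR u : u \in R -> rational_vec p H u.
    by case/setIdP => /setD1P[_ /(subsetP sUV) Vu]; apply: rational_vecV.
  have := rational_scarce p_pr abelV nVH p'H solH sBH ntU freeB G_gt1 dvHG ratH piH p_ge11 iota1 sR ratR.
  apply/negP; rewrite -leqNgt.
  have -> : #|('N_H(B) / B)%G| = #|H|.
    have DN : 'N_H(B)%g = H by apply/setIidPl; rewrite B1 norm1 subsetT.
    by rewrite card_quotient ?subsetIr //= DN B1 indexg1.
  apply: leq_trans (leq_mul few (leqnn _)); apply: (@leq_trans #|cover (nonrational_classes G)|).
    apply/subset_leq_card/subsetP => u /setDP[U1u]; rewrite inE U1u negbK /= => nrat_u.
    have [_ /(subsetP sUV)/(subsetP sVG) Gu] := setD1P U1u.
    by apply/bigcupP; exists (u ^: G)%g; rewrite ?class_refl //; apply: imset_f; rewrite inE Gu.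
  apply: leq_trans (leq_card_cover _) _; rewrite -sum_nat_const; apply: leq_sum => K.
  case/imsetP => u /setIdP[Gu nrat_u] ->; have Vu := nratV u Gu nrat_u.
  apply: leq_trans (leq_imset_card (fun h => u ^ h)%g H); apply/subset_leq_card/subsetP => x.
  by case/(classV Vu) => h Hh ->; apply: imset_f.
apply: (@full_false _ p V H B p_pr abelV nVH p'H solH sBH ntU freeB _ _ G_gt1 dvHG ratH piH p_ge11 _).
  by rewrite indexgg.
move=> u Uu ntu; have Vu := subsetP sUV u Uu; apply: rational_vecV => //.
apply: contra ntB => nrat_u; apply/eqP/trivgP/subsetP => c Bc; apply/set1gP.
by apply: (freeV u) => //; rewrite (freeB u).
Qed.

End MinimalCase.

(** Induction through a minimal normal [p]-subgroup [V]: a prime not covered by the quotient is [p]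
    itself, does not divide [#|G / V|], and so [V] has a complement by Schur-Zassenhaus. *)
Lemma few_nonrational_primes (gT : finGroupType) (G : {group gT}) s :
    solvable G -> (#|nonrational_classes G| <= 3)%N -> prime s -> (s %| #|G|)%N ->
  s \in [:: 2; 3; 5; 7]%N.
Proof.
have [n] := ubnP #|G|; elim: n => // n IHn in gT G s * => /ltnSE-leGn solG few s_pr s_dv.
have ntG : G :!=: 1%g.
  by apply: contraTneq s_dv => ->; rewrite cards1 dvdn1; case: eqP s_pr => // ->.
have [V minV sVG] := minnormal_exists ntG (normG G).
have [nVG ntV abelV_] := minnormal_solvable minV sVG solG.
have [p p_pr abelV] := is_abelemP abelV_.
have nsVG : V <| G by rewrite /normal sVG.
have IH r : prime r -> (r %| #|(G / V)%g|)%N -> r \in [:: 2; 3; 5; 7]%N.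
  apply: IHn; first exact: leq_trans (ltn_quotient ntV sVG) leGn.
    exact: quotient_sol.
  exact: leq_trans (nonrational_quotient nsVG) few.
have [s_dvQ | s'Q] := boolP (s %| #|(G / V)%g|)%N; first exact: IH.
have pV := abelem_pgroup abelV.
have Ds : s = p.
  move: s_dv; rewrite -(Lagrange sVG) -card_quotient // Euclid_dvdM // (negPf s'Q) orbF.
  by rewrite -[#|V|](part_pnat_id pV) p_part Euclid_dvdX // => /andP[]; rewrite dvdn_prime2 // => /eqP.
move: s'Q s_pr; rewrite Ds => p'Q _.
have hallV : Hall G V.
  rewrite /Hall sVG -card_quotient // (pnat_coprime pV) // p'natE //.
have /splitsP[H /complP[tiVH defG]] := SchurZassenhaus_split hallV nsVG.
have oH : #|H| = #|(G / V)%g|.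
  rewrite -(mulnK #|H| (cardG_gt0 V)) mulnC -(TI_cardMg tiVH) defG.
  by rewrite card_quotient // -divgS.
apply: contraT => notp; exfalso.
have p_ge11 : (11 <= p)%N.
  rewrite leqNgt; apply: contra notp => lt_p; move: p_pr lt_p; move: (p).
  by do 11?[case=> //].
apply: (minimal_false p_pr p_ge11 solG nsVG abelV ntV defG tiVH _ _ few); rewrite ?oH //.
Qed.

Local Close Scope ring_scope.
Local Open Scope nat_scope.

Theorem theoremB (gT : finGroupType) (G : {group gT}) :
  solvable G ->
  (#|irrational_classes G| = 2 \/ #|irrational_classes G| = 3) ->
  forall p : nat, p \in primes #|G| -> p \in [:: 2; 3; 5; 7].
Proof.
move=> solG few p; rewrite mem_primes => /and3P[p_pr _ p_dv].
apply: few_nonrational_primes solG _ p_pr p_dv.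
by apply: leq_trans (card_nonrational_le G) _; case: few => ->.
Qed.
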